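(* Let $p\geq 5$ and suppose that Assumptions 1--3 (stated in the context) hold. For every $r>0$ there exists $c^{\ast}=c^{\ast}(r)>0$ such that: (i) $S(c)\cap B(r)\neq\emptyset$ and $\nu^{r}_{c}>-\infty$ for every $0<c<c^{\ast}$. (ii) For every $0<c<c^{\ast}$ there exists $u\in H^{1}(\Gamma)$ with $u\in S(c)\cap B(r)$ such that $E(u)=\nu^{r}_{c}$. In particular, $\mathcal{M}^{r}_{c}$ is not empty.
   Context: Metric graph: $\Gamma$ has vertex set $V$ and edge set $J$; each edge $e\in J$ is identified with an interval $I_e=[0,L_e]$ of finite length $L_e>0$ (internal edge) or with $I_e=[0,\infty)$, $L_e=+\infty$ (external edge). Write $e\prec v$ if $e$ emanates from $v$. A function $u:\Gamma\to\mathbb{C}$ is a collection $(u_e)_{e\in J}$ of functions $u_e$ on $I_e$. $L^{q}(\Gamma)=\bigoplus_{e}L^{q}(I_e)$ with $\|u\|_{L^q}^q=\sum_e\|u_e\|_{L^q(I_e)}^q$; $H^{1}(\Gamma)=\{u\in C(\Gamma): u_e\in H^{1}(I_e)\ \forall e\in J\}$ with $\|u\|_{H^1}^2=\sum_{e}\|u_e\|_{H^1}^2$; $H^{2}(\Gamma)=\{u\in H^{1}(\Gamma):u_e\in H^2(I_e)\ \forall e\in J\}$. $\partial_o u_e(v)$ is the outward derivative of $u$ at $v$ along $e$. Operator: given a real-valued potential $W=(W_e)_{e\in J}$ on $\Gamma$ and real constants $\alpha_v$ ($v\in V$), $H$ is the operator $(Hu)_e=-u_e''+W_eu_e$ with vertex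 conditions $\sum_{e\prec v}\partial_o u_e(v)=-\alpha_v u(v)$ for all $v\in V$, with domain given as the $u\in H^2(\Gamma)$ satisfying these conditions; it is interpreted as the self-adjoint operator on $L^2(\Gamma)$ associated with the quadratic form $$\mathfrak{F}[u]=\int_\Gamma|u'|^2dx+\int_\Gamma W|u|^2dx-\sum_{v\in V}\alpha_v|u(v)|^2,\qquad \mathrm{dom}(\mathfrak F)=H^{1}(\Gamma).$$ Set $-\lambda_0:=\inf\{\mathfrak F[u]:u\in H^1(\Gamma),\ \|u\|_{L^2}^2=1\}$. Assumption 1: $\Gamma$ is a finite, connected metric graph with at least one external edge. Assumption 2: $W=W_+-W_-$ with $W_\pm\ge0$, $W_+\in L^1(\Gamma)+L^\infty(\Gamma)$, and $W_-\in L^{q}(\Gamma)$ for some $q\in[1,1+2/(p-1)]$. Assumption 3: $\lambda_0>0$ and $-\lambda_0$ is an isolated eigenvalue of $H$. Energy and constraint sets: $E(u)=\frac12\mathfrak F[u]-\frac1{p+1}\int_\Gamma|u|^{p+1}dx$ for $u\in H^1(\Gamma)$; for $c,r>0$, $S(c)=\{u\in H^1(\Gamma):\|u\|_{L^2}^2=c\}$, $\|u\|_G^2:=\mathfrak F[u]+2\lambda_0\|u\|_{L^2}^2$, $B(r)=\{u\in H^1(\Gamma):\|u\|_G^2\le r\}$, $\nu^r_c=\inf\{E(u):u\in S(c)\cap B(r)\}$, and $\mathcal M^r_c=\{\varphi\in S(c)\cap B(r):E(\varphi)=\nu^r_c\}$. *)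

(* Defs.v *)
From HB Require Import structures.
From mathcomp Require Import all_boot all_order all_algebra.
From mathcomp Require Import all_classical all_reals all_analysis.
From mathcomp Require Import complex.

Set Implicit Arguments.
Unset Strict Implicit.
Unset Printing Implicit Defensive.

Import Order.TTheory GRing.Theory Num.Theory.
Import numFieldNormedType.Exports.

Local Open Scope classical_set_scope.
Local Open Scope ring_scope.
Local Open Scope complex_scope.

Notation normc := (@ComplexField.Normc.normc _).
Local Notation Re := (@complex.Re _).
Local Notation Im := (@complex.Im _).

(* A finite metric graph (loops and multiple edges are allowed).  An internal
   edge e is [0, len e], attached to [tail e] at 0 and to [head e] at [len e];
   an external edge is [0, +oo[, attached to [root e] at 0. *)
Record metric_graph (R : realType) := MetricGraph {
  vertex : finType;
  internal : finType;
  external : finType;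
  len : internal -> R;
  len_gt0 : forall e, 0 < len e;
  tail : internal -> vertex;
  head : internal -> vertex;
  root : external -> vertex }.

Section MetricGraph.
Context {R : realType}.
Implicit Type G : metric_graph R.

Definition edge G : finType := (internal G + external G)%type.

Definition interval_of G (e : edge G) : set R :=
  match e with
  | inl e => `[0, len e]
  | inr _ => `[0, +oo[
  end.

Definition attached G (e : edge G) (x : R) (v : vertex G) : Prop :=
  match e with
  | inl e => (x = 0 /\ tail e = v) \/ (x = len e /\ head e = v)
  | inr e => x = 0 /\ root e = v
  end.

Definition adjacent G : rel (vertex G) := fun v w =>
  [exists e : internal G, ((tail e == v) && (head e == w))
                       || ((tail e == w) && (head e == v))].

Definition connected_graph G : Prop :=
  forall v w : vertex G, connect (@adjacent G) v w.

(* Only the values of [u e] on [interval_of e] are ever relevant. *)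
Definition graph_fun G := edge G -> R -> R[i].

Definition potential G := edge G -> R -> R.

End MetricGraph.

Section LebesgueSobolev.
Context {R : realType}.
Local Notation mu := (@lebesgue_measure R).
Implicit Types (I : set R) (f g u : R -> R[i]).

Definition Cintegral I f : R[i] :=
  (\int[mu]_(x in I) Re (f x)) +i* (\int[mu]_(x in I) Im (f x)).

Definition Lq_on I (q : \bar R) (f : R -> R) : Prop :=
  measurable_fun I f /\ finite_norm mu q (f \_ I).

Definition L2_on I f : Prop :=
  [/\ measurable_fun I (Re \o f), measurable_fun I (Im \o f) &
      finite_norm mu 2%:E ((normc \o f) \_ I)].

Definition C1_compact_support I (phi : R -> R) : Prop :=
  [/\ forall x, derivable phi x 1,
      continuous (derive1 phi) &
      exists K : set R, [/\ compact K, K `<=` I° &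
        forall x, ~ K x -> phi x = 0]].

Definition weak_derivative I u g : Prop :=
  L2_on I g /\
  forall phi, C1_compact_support I phi ->
    Cintegral I (fun x => u x * (derive1 phi x)%:C) =
    - Cintegral I (fun x => g x * (phi x)%:C).

Definition H1_on I u : Prop :=
  L2_on I u /\ exists g, weak_derivative I u g.

(* A weak derivative is unique almost everywhere on I, so that the choice made
   here does not affect any integral. *)
Definition wderiv I u : R -> R[i] :=
  xget (fun=> 0) [set g | weak_derivative I u g].

End LebesgueSobolev.

Section FunctionSpaces.
Context {R : realType} {G : metric_graph R}.
Local Notation mu := (@lebesgue_measure R).
Implicit Types (u v f : graph_fun G) (W : potential G).

Definition graph_integral (F : edge G -> R -> R) : R :=
  \sum_(e : edge G) \int[mu]_(x in interval_of e) F e x.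

Definition graph_Cintegral (F : graph_fun G) : R[i] :=
  \sum_(e : edge G) Cintegral (interval_of e) (F e).

Definition Lq (q : \bar R) W : Prop :=
  forall e, Lq_on (interval_of e) q (W e).

Definition L1_plus_Linfty W : Prop :=
  exists A B : potential G, [/\ Lq 1%:E A, Lq +oo%E B &
    forall e x, interval_of e x -> W e x = A e x + B e x].

Definition L2 u : Prop := forall e, L2_on (interval_of e) (u e).

Definition L2normsq u : R := graph_integral (fun e x => normc (u e x) ^+ 2).

Definition graph_continuous u : Prop :=
  (forall e, {within interval_of e, continuous (Re \o u e)} /\
             {within interval_of e, continuous (Im \o u e)}) /\
  (forall e x e' x' (v : vertex G),
     attached e x v -> attached e' x' v -> u e x = u e' x').

(* For continuous u all the values in this set coincide. *)
Definition at_vertex u (v : vertex G) : R[i] :=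
  xget 0 [set z | exists e x, attached e x v /\ z = u e x].

Definition H1 u : Prop :=
  graph_continuous u /\ forall e, H1_on (interval_of e) (u e).

Definition gderiv u : graph_fun G := fun e => wderiv (interval_of e) (u e).

End FunctionSpaces.

Section SchroedingerOperator.
Context {R : realType} {G : metric_graph R}.
Variables (W : potential G) (alpha : vertex G -> R).
Implicit Types (u v f : graph_fun G) (z : R[i]).

Definition qform u : R :=
  graph_integral (fun e x => normc (gderiv u e x) ^+ 2)
  + graph_integral (fun e x => W e x * normc (u e x) ^+ 2)
  - \sum_(v : vertex G) alpha v * normc (at_vertex u v) ^+ 2.

Definition sform u v : R[i] :=
  graph_Cintegral (fun e x => gderiv u e x * (gderiv v e x)^*)
  + graph_Cintegral (fun e x => (W e x)%:C * u e x * (v e x)^*)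
  - \sum_(w : vertex G) (alpha w)%:C * at_vertex u w * (at_vertex v w)^*.

(* The graph of the self-adjoint operator H on L^2 associated with the form:
   u is in the domain of H and H u = f.  Functions f that agree almost
   everywhere are not distinguished. *)
Definition schroedinger u f : Prop :=
  [/\ H1 u, L2 f & forall v, H1 v ->
      sform u v = graph_Cintegral (fun e x => f e x * (v e x)^*)].

Definition eigenvalue_H z : Prop :=
  exists u, schroedinger u (fun e x => z * u e x) /\ L2normsq u != 0.

(* H - z is a bijection from the domain of H onto L^2 with bounded inverse. *)
Definition resolvent_set_H : set R[i] := [set z |
  (forall u, schroedinger u (fun e x => z * u e x) -> L2normsq u = 0) /\
  exists M : R, forall f, L2 f -> exists u,
    schroedinger u (fun e x => z * u e x + f e x) /\
    L2normsq u <= M * L2normsq f].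

Definition spectrum_H : set R[i] := ~` resolvent_set_H.

Definition isolated_eigenvalue_H z : Prop :=
  eigenvalue_H z /\
  exists2 eps : R, 0 < eps &
    forall z', spectrum_H z' -> normc (z' - z) < eps -> z' = z.

(* [inf] is 0 for a set that is not bounded below, so that 0 < lambda0 entails
   that the infimum is a genuine one. *)
Definition lambda0 : R := - inf [set qform u | u in [set u | H1 u /\ L2normsq u = 1]].

Definition energy (p : R) u : R :=
  2^-1 * qform u
  - (p + 1)^-1 * graph_integral (fun e x => normc (u e x) `^ (p + 1)).

Definition mass_sphere (c : R) : set (graph_fun G) :=
  [set u | H1 u /\ L2normsq u = c].

Definition Gnormsq u : R := qform u + 2 * lambda0 * L2normsq u.

Definition Gball (r : R) : set (graph_fun G) :=
  [set u | H1 u /\ Gnormsq u <= r].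

Definition nu (p r c : R) : \bar R :=
  ereal_inf [set (energy p u)%:E | u in mass_sphere c `&` Gball r].

Definition minimizers (p r c : R) : set (graph_fun G) :=
  [set u | (mass_sphere c `&` Gball r) u /\ (energy p u)%:E = nu p r c].

End SchroedingerOperator.

Section Assumptions.
Context {R : realType}.

Definition assumption1 (G : metric_graph R) : Prop :=
  connected_graph G /\ (0 < #|external G|)%N.

Definition assumption2 (G : metric_graph R) (p : R) (W : potential G) : Prop :=
  exists Wp Wm : potential G,
  [/\ forall e x, interval_of e x ->
        [/\ 0 <= Wp e x, 0 <= Wm e x & W e x = Wp e x - Wm e x],
      L1_plus_Linfty Wp &
      exists2 q : R, 1 <= q <= 1 + 2 / (p - 1) & Lq q%:E Wm].

Definition assumption3 (G : metric_graph R) (W : potential G)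
    (alpha : vertex G -> R) : Prop :=
  0 < lambda0 W alpha /\
  isolated_eigenvalue_H W alpha (- lambda0 W alpha)%:C.

End Assumptions.

(* Main.v *)
Require Import Defs.
From HB Require Import structures.
From mathcomp Require Import all_boot all_order all_algebra.
From mathcomp Require Import all_classical all_reals all_analysis.
From mathcomp Require Import measurable_realfun ess_sup_inf complex.
From mathcomp Require Import ring lra.

(** Why minimizers exist although the problem is supercritical and mass can
    escape along the external edges.

    The negative part of the potential lies in L^q with q finite.  Hence it is an
    L^1 function up to an arbitrarily small constant ([le_powR_split]), and mass
    that escapes to infinity has asymptotically nonnegative quadratic energy,
    whereas the ground state has the negative energy - lambda0 per unit of mass.
    This gap is what prevents any loss of mass.

    The form controls the Dirichlet integral ([qform_coercive]) because on a
    metric graph the supremum is controlled by the Dirichlet integral with an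
    arbitrarily small constant ([H1_sup]).  So on S(c) /\ B(r) functions have a
    bounded Dirichlet integral and, for c small depending on r, a supremum at most
    any given k ([small_mass_bounded]).  There the nonlinear term is at most k
    times the mass, however large p is: this gives the finiteness of the infimum nu, and
    the constraint makes the supercritical nonlinearity a small perturbation.
    Scaling an almost minimal function for lambda0 shows that S(c) /\ B(r) is not
    empty and that 2 nu <= - lambda0 c / 2 ([competitor]).

    A minimizing sequence is bounded in H^1 and has a subsequence that converges
    pointwise to some u in H^1, with lower semicontinuous Dirichlet integral
    ([H1_compactness]).  Write m = c - |u|^2 >= 0 for the mass that is lost, F for
    the quadratic form and N for 2 / (p + 1) times the nonlinear integral, so that
    2 E = F - N.  Fatou's lemma, applied after adding to the integrand what makes
    it nonnegative, yields F(u) - N(u) <= 2 nu + k m ([potential_liminf]).  With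
    k <= lambda0 / 4 this makes F(u) negative; so u is not zero, and the rescaled
    function t u of mass c, with t^2 = c / |u|^2 >= 1, satisfies the constraint of
    the ball.  Comparing energies gives 2 nu <= t^2 (F(u) - N(u)), that is
    m (2 nu + k c) >= 0, hence m = 0.  Then u itself is a minimizer.

    The compactness result rests on two elementary facts.  Bounded sequences of
    L^2 have weak limits, with a lower semicontinuous norm ([weak_compactness]),
    and weak derivatives tested against smoothed indicator functions of intervals
    give Hoelder continuity ([weak_derivative_hoelder]) and uniqueness
    ([weak_derivative_unique]). *)

Set Implicit Arguments.
Unset Strict Implicit.
Unset Printing Implicit Defensive.

Import Order.TTheory GRing.Theory Num.Theory.
Import numFieldNormedType.Exports.

Local Open Scope classical_set_scope.
Local Open Scope ring_scope.

(** * Lower limits and Fatou's lemma for real-valued functions *)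

Section liminf.
Context {R : realType}.
Implicit Types (x y : R) (u v : R^nat).

(** [x] is at most the lower limit of [u].  In this form the lower limit may be
    infinite and needs no name, and finite sums are immediate. *)
Definition le_liminf x u := forall eps, 0 < eps -> \forall n \near \oo, x <= u n + eps.

Lemma le_liminfD x y u v : le_liminf x u -> le_liminf y v ->
  le_liminf (x + y) (u \+ v).
Proof.
move=> hx hy eps e0; have e2 : 0 < eps / 2 by lra.
near=> n; have : x <= u n + eps / 2 by near: n; exact: hx.
have : y <= v n + eps / 2 by near: n; exact: hy.
rewrite /=; lra.
Unshelve. all: end_near. Qed.

Lemma le_liminf_cst x : le_liminf x (fun=> x).
Proof. by move=> e e0; apply: nearW => n; lra. Qed.

Lemma le_liminf_sum (I : finType) (x : I -> R) (u : I -> R^nat) :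
  (forall i, le_liminf (x i) (u i)) ->
  le_liminf (\sum_i x i) (fun n => \sum_i u i n).
Proof.
move=> h; move: (index_enum I) => s; elim: s => [|i s ih].
  rewrite big_nil (_ : (fun n => _) = (fun=> 0)); first exact: le_liminf_cst.
  by apply/funext => n; rewrite big_nil.
rewrite big_cons (_ : (fun n => _) = u i \+ (fun n => \sum_(j <- s) u j n)).
  exact: le_liminfD.
by apply/funext => n; rewrite big_cons.
Qed.

Lemma cvg_le_liminf x u : u @ \oo --> x -> le_liminf x u.
Proof.
move=> /cvgrPdist_lt ux eps e0; near=> n.
have : `|x - u n| < eps by near: n; exact: ux.
by rewrite ltr_norml => /andP[_ ?]; lra.
Unshelve. all: end_near. Qed.

Lemma le_liminf_le x u v : (forall n, u n <= v n) -> le_liminf x u -> le_liminf x v.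
Proof.
move=> uv h e e0; near=> n.
have : x <= u n + e by near: n; exact: h.
by have := uv n; lra.
Unshelve. all: end_near. Qed.

Lemma le_liminf_lim x l u : u @ \oo --> l -> le_liminf x u -> x <= l.
Proof.
move=> /cvgrPdist_lt ul xu; apply/ler_addgt0Pr => e e0.
have e2 : 0 < e / 2 by lra.
have [n [h1 h2]] : exists n, x <= u n + e / 2 /\ `|l - u n| < e / 2.
  have : \forall n \near \oo, x <= u n + e / 2 /\ `|l - u n| < e / 2.
    near=> n; split; near: n; [exact: xu|exact: ul].
  by move=> [N _ /(_ N (leqnn N))]; exists N.
move: h2; rewrite ltr_norml => /andP[h2 _]; lra.
Unshelve. all: end_near. Qed.

End liminf.

Section real_integrals.
Context d {T : measurableType d} {R : realType}.
Variables (mu : {measure set T -> \bar R}) (D : set T) (mD : measurable D).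
Implicit Types f g h : T -> R.
Local Notation integ f := (mu.-integrable D (EFin \o f)).
Local Notation int f := (Rintegral mu D f).

Lemma integ_mfun f : integ f -> measurable_fun D f.
Proof. by move=> /measurable_int/measurable_EFinP. Qed.

Lemma integ_le f g : measurable_fun D f -> integ g ->
  (forall x, D x -> `|f x| <= g x) -> integ f.
Proof.
move=> mf ig fg; apply: (le_integrable mD _ _ ig); first exact/measurable_EFinP.
move=> x Dx /=; rewrite lee_fin (le_trans (fg _ Dx))//; exact: ler_norm.
Qed.

Lemma integD f g : integ f -> integ g -> integ (fun x => f x + g x).
Proof. by move=> fi gi; have := integrableD mD fi gi. Qed.

Lemma integB f g : integ f -> integ g -> integ (fun x => f x - g x).
Proof. by move=> fi gi; have := integrableB mD fi gi. Qed.

Lemma integZ k f : integ f -> integ (fun x => k * f x).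
Proof. by move=> fi; have := integrableZl mD k fi. Qed.

Lemma eq_integ f g : {in D, f =1 g} -> integ f -> integ g.
Proof. by move=> fg; apply: eq_integrable => // x xD /=; rewrite fg. Qed.

Lemma intE f : integ f -> (int f)%:E = (\int[mu]_(x in D) (f x)%:E)%E.
Proof. by move=> fi; rewrite fineK//; exact: integrable_fin_num. Qed.

Lemma int_le_integ f A : measurable_fun D f -> (forall x, D x -> 0 <= f x) ->
  (\int[mu]_(x in D) (f x)%:E <= A%:E)%E -> integ f /\ int f <= A.
Proof.
move=> mf f0 fA; have fi : integ f.
  apply/integrableP; split; first exact/measurable_EFinP.
  apply: le_lt_trans (ltry A); apply: le_trans fA.
  rewrite le_eqVlt; apply/orP; left; apply/eqP; apply: eq_integral => x.
  by rewrite inE => /f0 ?; rewrite /= ger0_norm.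
by split => //; rewrite -lee_fin intE.
Qed.

(** The uniform bound on the integrals makes the limit integrable, so that the
    conclusion of Fatou's lemma can be read in the real numbers. *)
Lemma fatou_real (f_ : (T -> R)^nat) f A :
  (forall n, integ (f_ n)) -> (forall n x, D x -> 0 <= f_ n x) ->
  measurable_fun D f -> (forall x, D x -> 0 <= f x) ->
  {ae mu, forall x, D x -> f_ ^~ x @ \oo --> f x} ->
  (forall n, int (f_ n) <= A) ->
  integ f /\ le_liminf (int f) (fun n => int (f_ n)).
Proof.
move=> fi f0 mf f0' cf fA.
have mf_ n : measurable_fun D (EFin \o f_ n) by exact: measurable_int (fi n).
have f0e n x : D x -> (0 <= (EFin \o f_ n) x)%E by move=> Dx; rewrite lee_fin f0.
have := fatou mu mD mf_ f0e.
have -> : (\int[mu]_(x in D) limn_einf (fun n => (EFin \o f_ n) x) =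
          \int[mu]_(x in D) (f x)%:E)%E.
  apply: ae_eq_integral => //.
  - apply: measurableT_comp => //.
    apply: (@measurable_fun_limn_esup _ _ _ D (fun n x => - (EFin \o f_ n) x)%E).
    by move=> n; exact: measurableT_comp.
  - exact/measurable_EFinP.
  - apply: filterS cf => x xf Dx.
    have cx : (fun n => (EFin \o f_ n) x) @ \oo --> (f x)%:E.
      by apply/cvg_EFin; [exact: nearW|exact: xf].
    rewrite is_cvg_limn_einfE; last by apply/cvg_ex; exists (f x)%:E.
    exact/cvg_lim.
rewrite (_ : (fun n => _) = (fun n => (int (f_ n))%:E)); last first.
  by apply/funext => n; rewrite intE.
move=> fat.
have key eps : 0 < eps -> forall F, (F <= \int[mu]_(x in D) (f x)%:E)%E -> F \is a fin_num ->
    \forall n \near \oo, (F - eps%:E <= (int (f_ n))%:E)%E.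
  move=> e0 F FI Ff; have : (F - eps%:E < limn_einf (fun n => (int (f_ n))%:E))%E.
    rewrite (lt_le_trans _ fat)// (lt_le_trans _ FI)//.
    by rewrite lteBlDr// lteDl// lte_fin.
  rewrite limn_einf_lim (cvg_lim _ (@cvg_einfs_sup _ _))//.
  move=> /ereal_sup_gt[_ [N _ <-]] FN.
  exists N => // n /= Nn; apply/ltW; apply: (lt_le_trans FN).
  by apply: ereal_inf_lbound; exists n.
have fI : (\int[mu]_(x in D) (f x)%:E <= A%:E)%E.
  rewrite leNgt; apply/negP => AI.
  have := fat; rewrite leNgt => /negP; apply.
  apply: le_lt_trans AI.
  rewrite limn_einf_lim (cvg_lim _ (@cvg_einfs_sup _ _))//.
  apply: ge_ereal_sup => _ [N _ <-].
  apply: (@le_trans _ _ (int (f_ N))%:E); last by rewrite lee_fin fA.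
  by apply: ereal_inf_lbound; exists N => /=.
have [fint _] := int_le_integ mf f0' fI; split => // e e0.
have := key e e0 (int f)%:E; rewrite intE// lexx => /(_ erefl).
rewrite -intE// => /(_ erefl); apply: filterS => n.
by rewrite -EFinB lee_fin lerBlDr.
Qed.

End real_integrals.

(** * Square-integrable functions and completeness of L^2 *)

Section square_integrable.
Context d {T : measurableType d} {R : realType}.
Variables (mu : {measure set T -> \bar R}) (D : set T) (mD : measurable D).
Implicit Types f g h : T -> R.
Local Notation integ f := (mu.-integrable D (EFin \o f)).
Local Notation int f := (Rintegral mu D f).

Definition sqint f := measurable_fun D f /\ integ (fun x => f x ^+ 2).

Lemma sqint_mul f g : sqint f -> sqint g -> integ (fun x => f x * g x).
Proof.
move=> [mf fi] [mg gi]; apply: (integ_le mD _ (integD mD fi gi)).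
  exact: measurable_funM.
move=> x _; rewrite normrM -[f x ^+ 2]real_normK ?num_real//.
rewrite -[g x ^+ 2]real_normK ?num_real//.
have := sqr_ge0 (`|f x| - `|g x|); have := sqr_ge0 (`|f x| + `|g x|).
have := normr_ge0 (f x); have := normr_ge0 (g x); nra.
Qed.

Lemma sqint_comb a b f g : sqint f -> sqint g ->
  sqint (fun x => a * f x + b * g x).
Proof.
move=> hf hg; split.
  have [mf _] := hf; have [mg _] := hg.
  exact: measurable_funD (measurable_funM (measurable_cst a) mf)
    (measurable_funM (measurable_cst b) mg).
have ifg := sqint_mul hf hg.
have h := integD mD (integZ mD (a ^+ 2) hf.2)
  (integD mD (integZ mD (2 * a * b) ifg) (integZ mD (b ^+ 2) hg.2)).
by apply: (eq_integ mD _ h) => x _ /=; ring.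
Qed.

Lemma sqint_sub f g : sqint f -> sqint g -> sqint (fun x => f x - g x).
Proof.
move=> hf hg; have [m i] := sqint_comb 1 (-1) hf hg.
have e : (fun x => 1 * f x + -1 * g x) = (fun x => f x - g x).
  by apply/funext => x; ring.
by rewrite -e.
Qed.

Lemma int_sqr_comb a b f g : sqint f -> sqint g ->
  int (fun x => (a * f x + b * g x) ^+ 2) =
  a ^+ 2 * int (fun x => f x ^+ 2) + 2 * a * b * int (fun x => f x * g x) +
  b ^+ 2 * int (fun x => g x ^+ 2).
Proof.
move=> hf hg; have ifg := sqint_mul hf hg.
have i1 := integZ mD (a ^+ 2) hf.2; have i2 := integZ mD (2 * a * b) ifg.
have i3 := integZ mD (b ^+ 2) hg.2.
rewrite -(RintegralZl (a ^+ 2) mD hf.2) -(RintegralZl (2 * a * b) mD ifg).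
rewrite -(RintegralZl (b ^+ 2) mD hg.2) -(RintegralD mD i1 i2).
rewrite -(RintegralD mD (integD mD i1 i2) i3).
by apply: eq_Rintegral => x _; ring.
Qed.

Lemma int_sqr_ge0 f : 0 <= int (fun x => f x ^+ 2).
Proof. by apply: Rintegral_ge0 => x _; exact: sqr_ge0. Qed.

(** The integral of (a f + b g)^2 is a nonnegative quadratic form in (a, b). *)
Lemma cauchy_schwarz f g : sqint f -> sqint g ->
  int (fun x => f x * g x) ^+ 2 <=
  int (fun x => f x ^+ 2) * int (fun x => g x ^+ 2).
Proof.
move=> hf hg; set A := int (fun x => f x ^+ 2).
set B := int (fun x => g x ^+ 2); set C := int _.
have A0 : 0 <= A by exact: int_sqr_ge0.
have B0 : 0 <= B by exact: int_sqr_ge0.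
have key a b : 0 <= a ^+ 2 * A + 2 * a * b * C + b ^+ 2 * B.
  by rewrite -int_sqr_comb// int_sqr_ge0.
have [A1|A1] := eqVneq A 0.
  (* the quadratic polynomial degenerates to an affine one *)
  have [->|C1] := eqVneq C 0; first by rewrite A1 mul0r expr0n.
  have := key (- (B + 1) / C) 1.
  have -> : 2 * (- (B + 1) / C) * 1 * C = - 2 * (B + 1) by field.
  by rewrite A1; lra.
have A2 : 0 < A by rewrite lt_neqAle eq_sym A1.
have := key (- C) A.
have -> : (- C) ^+ 2 * A + 2 * (- C) * A * C + A ^+ 2 * B = A * (A * B - C ^+ 2) by ring.
by rewrite pmulr_rge0// subr_ge0.
Qed.

Lemma parallelogram f g : sqint f -> sqint g ->
  int (fun x => (f x - g x) ^+ 2) =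
  2 * int (fun x => f x ^+ 2) + 2 * int (fun x => g x ^+ 2)
  - 4 * int (fun x => (2^-1 * f x + 2^-1 * g x) ^+ 2).
Proof.
move=> hf hg; rewrite int_sqr_comb//.
rewrite (@eq_Rintegral _ _ _ _ _ (fun x => (1 * f x + -1 * g x) ^+ 2)).
  by rewrite int_sqr_comb//; field.
by move=> x _; ring.
Qed.

Lemma geometric_cvg0 (q C : R) : 0 <= q < 1 -> (fun n => C * q ^+ n) @ \oo --> (0:R).
Proof.
move=> /andP[q0 q1]; rewrite -(mulr0 C); apply: cvgM; first exact: cvg_cst.
by apply: cvg_expr; rewrite ger0_norm.
Qed.

(** The bound makes the increments at most sqrt s / 2^n, hence summable. *)
Lemma fast_cauchy_cvg (u : R^nat) (s : R) :
  (forall n, 4 ^+ n * (u n.+1 - u n) ^+ 2 <= s) -> cvgn u.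
Proof.
move=> us; have s0 : 0 <= s by rewrite (le_trans _ (us 0%N))// mulr_ge0 ?sqr_ge0.
have du n : `|u n.+1 - u n| <= Num.sqrt s * 2^-1 ^+ n.
  rewrite -(@ler_pXn2r _ 2)// ?nnegrE ?normr_ge0 ?mulr_ge0 ?sqrtr_ge0 ?exprn_ge0//.
  rewrite real_normK ?num_real// exprMn sqr_sqrtr//.
  rewrite -exprM mulnC exprM.
  have -> : (2^-1 ^+ 2 : R) = 4^-1 by field.
  rewrite exprVn ler_pdivlMr ?exprn_gt0//; last by rewrite mulrC us.
suff : cvgn (series (fun n => u n.+1 - u n)).
  move=> h; have -> : u = (fun n => u 0%N + series (fun n => u n.+1 - u n) n).
    apply/funext => n; rewrite seriesEnat /= telescope_sumr//; lra.
  by apply: is_cvgD => //; exact: is_cvg_cst.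
apply: normed_cvg; apply: (series_le_cvg _ _ du).
- by move=> n; exact: normr_ge0.
- by move=> n; rewrite /= mulr_ge0// ?sqrtr_ge0// exprn_ge0.
- by apply: is_cvg_geometric_series; rewrite ger0_norm//; lra.
Qed.

(** Completeness of L^2 along a geometrically Cauchy sequence.  The weighted
    series of 4^n (h_{n+1} - h_n)^2 has finite integral, so it is finite almost
    everywhere, where [fast_cauchy_cvg] provides the limit; the estimate then
    follows from Fatou's lemma. *)
Lemma riesz_fischer (h : nat -> T -> R) (C : R) :
  (forall n, sqint (h n)) ->
  (forall n m, (n <= m)%N -> int (fun x => (h m x - h n x) ^+ 2) <= C * 8^-1 ^+ n) ->
  exists2 g, sqint g & forall n, int (fun x => (g x - h n x) ^+ 2) <= C * 8^-1 ^+ n.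
Proof.
move=> hL hC.
have C0 : 0 <= C.
  by have := le_trans (int_sqr_ge0 _) (hC 0%N 0%N (leqnn _)); rewrite expr0 mulr1.
have dL n : sqint (fun x => h n.+1 x - h n x) by exact: sqint_sub.
pose t n x := 4 ^+ n * (h n.+1 x - h n x) ^+ 2.
have ti n : integ (t n) by exact: integZ (dL n).2.
have t0 n x : 0 <= t n x by rewrite mulr_ge0 ?sqr_ge0 ?exprn_ge0.
pose S x := (\sum_(0 <= n <oo) (t n x)%:E)%E.
have mS : measurable_fun D S.
  apply: ge0_emeasurable_sum => [n x _ _|n _]; first by rewrite lee_fin.
  exact: measurable_int (ti n).
have S0 x : (0 <= S x)%E by apply: nneseries_ge0 => n _ _; rewrite lee_fin.
have iS : mu.-integrable D S.
  apply/integrableP; split => //.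
  under eq_integral do rewrite gee0_abs//.
  rewrite integral_nneseries//; last 2 first.
  - by move=> n; exact: measurable_int (ti n).
  - by move=> n x _; rewrite lee_fin.
  apply: (@le_lt_trans _ _ (\sum_(0 <= n <oo) ((2 * C) / (2 ^ n.+1)%:R)%:E)%E).
    apply: lee_nneseries => [n _ _|n _].
      by apply: integral_ge0 => x _; rewrite lee_fin.
    rewrite -(intE mD (ti n)) lee_fin /t (RintegralZl _ mD (dL n).2).
    apply: le_trans (ler_wpM2l _ (hC n n.+1 (leqnSn n))) _.
      exact: exprn_ge0.
    rewrite expnS natrM natrX exprVn.
    have -> : (8 ^+ n = 4 ^+ n * 2 ^+ n :> R) by rewrite -exprMn; congr (_ ^+ _); ring.
    have h4 : 0 < 4 ^+ n :> R by exact: exprn_gt0.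
    have h2 : 0 < 2 ^+ n :> R by exact: exprn_gt0.
    rewrite le_eqVlt; apply/orP; left; apply/eqP; field.
    by rewrite !lt0r_neq0.
  by apply: le_lt_trans (epsilon_trick0 _ _) (ltry (2 * C)); rewrite mulr_ge0.
have Sfin := integrable_ae mD iS.
have hcv : {ae mu, forall x, D x -> cvgn (h ^~ x)}.
  apply: filterS Sfin => x xS Dx; have Sx := xS Dx.
  apply: (@fast_cauchy_cvg _ (fine (S x))) => n.
  rewrite -lee_fin fineK//.
  apply: le_trans (nneseries_lim_ge n.+1 _) => //=; last first.
    by move=> k _ _; rewrite lee_fin.
  rewrite big_nat_recr//= -[leLHS]add0e leeD//.
  by rewrite sume_ge0// => k _; rewrite lee_fin.
pose g x := fine (limn_esup (fun n => (h n x)%:E)).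
have mg : measurable_fun D g.
  apply: measurableT_comp => //; apply: measurable_fun_limn_esup => n.
  by apply/measurable_EFinP; exact: (hL n).1.
have gh : {ae mu, forall x, D x -> h ^~ x @ \oo --> g x}.
  apply: filterS hcv => x xc Dx; have /cvg_ex[l hl] := xc Dx.
  have cl : (fun n => (h n x)%:E) @ \oo --> l%:E.
    by apply/cvg_EFin; [exact: nearW|exact: hl].
  rewrite /g is_cvg_limn_esupE; last by apply/cvg_ex; exists l%:E.
  by rewrite (cvg_lim _ cl).
have gn n : integ (fun x => (g x - h n x) ^+ 2) /\
    int (fun x => (g x - h n x) ^+ 2) <= C * 8^-1 ^+ n.
  have [i l] : integ (fun x => (g x - h n x) ^+ 2) /\
      le_liminf (int (fun x => (g x - h n x) ^+ 2))
        (fun m => int (fun x => (h (n + m)%N x - h n x) ^+ 2)).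
    apply: (@fatou_real _ _ _ mu D mD (fun m x => (h (n + m)%N x - h n x) ^+ 2)
      _ (C * 8^-1 ^+ n)).
    - by move=> m; exact: (sqint_sub (hL _) (hL _)).2.
    - by move=> m x _; exact: sqr_ge0.
    - apply: measurable_funX; apply: measurable_funB => //; exact: (hL n).1.
    - by move=> x _; exact: sqr_ge0.
    - apply: filterS gh => x xg Dx.
      have c1 : h (n + m)%N x @[m --> \oo] --> g x.
        exact: cvg_comp (cvg_addnl n) (xg Dx).
      have c2 : (h (n + m)%N x - h n x) @[m --> \oo] --> g x - h n x.
        by apply: cvgB => //; exact: cvg_cst.
      by under eq_fun do rewrite expr2; rewrite expr2; apply: cvgM.
    - by move=> m; apply: hC; exact: leq_addr.
  split => //; apply: (le_liminf_lim (cvg_cst _)) => e e0.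
  apply: filterS (l e e0) => m /le_trans; apply; rewrite lerD2r.
  by apply: hC; exact: leq_addr.
exists g; last by move=> n; have [] := gn n.
have hg : sqint (fun x => g x - h 0%N x).
  split; last by have [] := gn 0%N.
  by apply: measurable_funB => //; exact: (hL 0%N).1.
have [m i] := sqint_comb 1 1 hg (hL 0%N).
split => //; apply: (eq_integ mD _ i) => x _ /=; congr (_ ^+ 2); ring.
Qed.

End square_integrable.

(** * Weak compactness in L^2 *)

Section weak_compactness.
Context d {T : measurableType d} {R : realType}.
Variables (mu : {measure set T -> \bar R}) (D : set T) (mD : measurable D).
Local Notation int f := (Rintegral mu D f).
Local Notation sqint := (sqint mu D).

Lemma near_geometric (C e : R) : 0 < e -> \forall n \near \oo, C * 8^-1 ^+ n <= e.
Proof.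
move=> e0; have q : 0 <= (8^-1 : R) < 1 by apply/andP; split; lra.
have /cvgrPdist_le/(_ e e0) := geometric_cvg0 C q.
by apply: filterS => n; rewrite sub0r normrN => /(le_trans (ler_norm _)).
Qed.

(** Weak compactness of balls of L^2, with lower semicontinuity of the norm, by
    a variational form of Mazur's lemma.  The set [C n] of functions that do at
    least as well as the tail (g_k), k >= n, against every test function is
    convex, decreases with n and contains that tail.  Almost minimal elements of
    these sets are Cauchy by the parallelogram identity, and their limit is the
    weak limit.  Its norm is at most the supremum of the minimal norms, and each
    of them is at most the norm of any element of the corresponding tail. *)
Lemma weak_compactness (P : set (T -> R)) (ell : (T -> R) -> R)
    (g : nat -> T -> R) (A : R) :
  (forall phi, P phi -> sqint phi) ->
  (forall n, sqint (g n)) -> (forall n, int (fun x => g n x ^+ 2) <= A) ->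
  (forall phi, P phi -> int (fun x => g n x * phi x) @[n --> \oo] --> ell phi) ->
  exists g', [/\ sqint g', forall phi, P phi -> int (fun x => g' x * phi x) = ell phi &
    le_liminf (int (fun x => g' x ^+ 2)) (fun n => int (fun x => g n x ^+ 2))].
Proof.
move=> PL gL gA gl.
pose C n := [set h | sqint h /\ forall phi, P phi -> forall eta,
  (forall k, (n <= k)%N -> `|int (fun x => g k x * phi x) - ell phi| <= eta) ->
  `|int (fun x => h x * phi x) - ell phi| <= eta].
pose Q n := [set int (fun x => h x ^+ 2) | h in C n].
have Cg n k : (n <= k)%N -> C n (g k) by move=> nk; split => // phi Pp eta; exact.
have Csub n m : (n <= m)%N -> C m `<=` C n.
  move=> nm h [hL hC]; split=> // phi Pp eta He; apply: hC => // k mk.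
  by apply: He; exact: leq_trans nm mk.
have Qlb n : lbound (Q n) 0 by move=> _ [h _ <-]; exact: int_sqr_ge0.
have Qinf n : has_inf (Q n).
  by split; [exists (int (fun x => g n x ^+ 2)), (g n) => //; exact: Cg|exists 0].
(* the squared distance from the origin to [C n] *)
pose v n := inf (Q n).
have vh n h : C n h -> v n <= int (fun x => h x ^+ 2).
  by move=> Ch; apply: ge_inf; [exact: (Qinf n).2|exists h].
have vnd n m : (n <= m)%N -> v n <= v m.
  move=> nm; apply: lb_le_inf; first exact: (Qinf m).1.
  by move=> _ [h Ch <-]; apply: vh; exact: Csub Ch.
have vsup : has_sup (range v).
  split; first by exists (v 0%N), 0%N.
  by exists A => _ [n _ <-]; apply: le_trans (gA n); apply: vh; exact: Cg.
pose dd := sup (range v).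
have vd n : v n <= dd by apply: ub_le_sup; [exact: vsup.2|exists n].
have vnear e : 0 < e -> exists N, dd - e < v N.
  by move=> e0; have [_ [N _ <-] ?] := sup_adherent e0 vsup; exists N.
have q0 j : 0 < (8^-1 : R) ^+ j by exact: exprn_gt0.
(* an almost minimal element, in a set whose distance is almost the supremum *)
have ex j : exists Nh : nat * (T -> R), [/\ (j <= Nh.1)%N, dd - 8^-1 ^+ j < v Nh.1,
    C Nh.1 Nh.2 & int (fun x => Nh.2 x ^+ 2) <= dd + 8^-1 ^+ j].
  have [N HN] := vnear _ (q0 j).
  have [_ [h Ch <-] hh] := inf_adherent (q0 j) (Qinf (maxn j N)).
  exists (maxn j N, h); split => //=.
  - exact: leq_maxl.
  - by apply: lt_le_trans HN _; apply: vnd; exact: leq_maxr.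
  - by apply/ltW/(lt_le_trans hh); rewrite lerD2r; exact: vd.
pose N j := (projT1 (cid (ex j))).1; pose h j := (projT1 (cid (ex j))).2.
have Hh j : [/\ (j <= N j)%N, dd - 8^-1 ^+ j < v (N j),
    C (N j) (h j) & int (fun x => h j x ^+ 2) <= dd + 8^-1 ^+ j].
  by rewrite /N /h; case: cid.
have hL j : sqint (h j) by have [_ _ []] := Hh j.
have hcauchy n m : (n <= m)%N ->
    int (fun x => (h m x - h n x) ^+ 2) <= 8 * 8^-1 ^+ n.
  move=> nm; rewrite parallelogram//.
  have [_ v1 C1 i1] := Hh n; have [_ v2 C2 i2] := Hh m.
  have qq : (8^-1 : R) ^+ m <= 8^-1 ^+ n.
    by apply: ler_wiXn2l => //; lra.
  pose k := minn (N n) (N m).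
  have vk : dd - 8^-1 ^+ n <= v k.
    rewrite /k /minn; case: ifP => _; [exact: ltW|lra].
  suff Cm : C k (fun x => 2^-1 * h m x + 2^-1 * h n x) by have := vh _ _ Cm; lra.
  have [_ D1] := Csub _ _ (geq_minl (N n) (N m)) _ C1.
  have [_ D2] := Csub _ _ (geq_minr (N n) (N m)) _ C2.
  split; first exact: sqint_comb.
  move=> phi Pp eta He; have E1 := D1 _ Pp _ He; have E2 := D2 _ Pp _ He.
  have i1' := sqint_mul mD (hL n) (PL _ Pp); have i2' := sqint_mul mD (hL m) (PL _ Pp).
  rewrite (@eq_Rintegral _ _ _ _ _
    (fun x => 2^-1 * (h m x * phi x) + 2^-1 * (h n x * phi x))); last first.
    by move=> x _; ring.
  rewrite (RintegralD mD (integZ mD _ i2') (integZ mD _ i1')) !RintegralZl//.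
  by move: E1 E2; rewrite !ler_norml => /andP[? ?] /andP[? ?]; apply/andP; split; lra.
have [g' g'L g'h] := riesz_fischer mD hL hcauchy.
have kL n := sqint_sub mD g'L (hL n).
exists g'; split => //.
- move=> phi Pp; apply/eqP; rewrite -subr_eq0 -normr_eq0 eq_le normr_ge0 andbT.
  apply/ler_addgt0Pr => e e0; rewrite add0r.
  have e2 : 0 < e / 2 by lra.
  set Phi := int (fun x => phi x ^+ 2).
  have /cvgrPdist_le/(_ _ e2)[K _ HK] := gl _ Pp.
  have [M _ HM] := near_geometric (8 * Phi) (exprn_gt0 2 e2).
  pose n := maxn K M.
  have Kn : (K <= n)%N by exact: leq_maxl.
  have [nN _ [_ /(_ _ Pp (e / 2)) Cn] _] := Hh n.
  have b1 : `|int (fun x => h n x * phi x) - ell phi| <= e / 2.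
    apply: Cn => k Nk; rewrite distrC; apply: HK => /=.
    by rewrite (leq_trans Kn)// (leq_trans nN).
  have b2 : `|int (fun x => (g' x - h n x) * phi x)| <= e / 2.
    rewrite -(@ler_pXn2r _ 2) ?nnegrE//; last exact: ltW.
    rewrite real_normK ?num_real//.
    apply: le_trans (cauchy_schwarz mD (kL n) (PL _ Pp)) _.
    apply: le_trans (HM n (leq_maxr _ _)).
    rewrite -/Phi mulrAC ler_wpM2r//; exact: int_sqr_ge0.
  have -> : int (fun x => g' x * phi x) =
      int (fun x => (g' x - h n x) * phi x) + int (fun x => h n x * phi x).
    rewrite -(RintegralD mD (sqint_mul mD (kL n) (PL _ Pp)) (sqint_mul mD (hL n) (PL _ Pp))).
    by apply: eq_Rintegral => x _; ring.
  by move: b1 b2; rewrite !ler_norml => /andP[? ?] /andP[? ?]; apply/andP; split; lra.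
- have g'd : int (fun x => g' x ^+ 2) <= dd.
    apply/ler_addgt0Pr => e e0; have e4 : 0 < e / 4 by lra.
    have [K1 _ H1] := near_geometric 1 e4.
    have [K2 _ H2] := near_geometric 8 e4.
    have [K3 _ H3] := near_geometric (8 * (dd + 1)) (exprn_gt0 2 e4).
    pose n := maxn K1 (maxn K2 K3).
    have {}H1 := H1 n (leq_maxl _ _).
    have {}H2 : 8 * 8^-1 ^+ n <= e / 4.
      by apply: H2 => /=; rewrite /n (leq_trans (leq_maxl K2 K3))// leq_maxr.
    have {}H3 : 8 * (dd + 1) * 8^-1 ^+ n <= (e / 4) ^+ 2.
      by apply: H3 => /=; rewrite /n (leq_trans (leq_maxr K2 K3))// leq_maxr.
    have [_ _ _ hn] := Hh n; have gn := g'h n.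
    have -> : int (fun x => g' x ^+ 2) =
        int (fun x => (1 * h n x + 1 * (g' x - h n x)) ^+ 2).
      by apply: eq_Rintegral => x _; congr (_ ^+ 2); ring.
    rewrite int_sqr_comb//.
    have X : int (fun x => h n x * (g' x - h n x)) <= e / 4.
      apply: le_trans (ler_norm _) _.
      rewrite -(@ler_pXn2r _ 2) ?nnegrE//; last exact: ltW.
      rewrite real_normK ?num_real//.
      apply: le_trans (cauchy_schwarz mD (hL n) (kL n)) _.
      apply: le_trans H3; rewrite mulrAC mulrC.
      apply: ler_pM => //; [exact: int_sqr_ge0|exact: int_sqr_ge0|].
      apply: (le_trans hn); rewrite lerD2l; apply: exprn_ile1 => //; lra.
    lra.
  move=> e e0; have [M HM] := vnear _ e0.
  exists M => // n /= Mn; have := vh n (g n) (Cg n n (leqnn n)).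
  have := vnd _ _ Mn; lra.
Qed.

End weak_compactness.

(** * Spline test functions *)

Section test_functions.
Context {R : realType}.
Local Notation mu := (@lebesgue_measure R).
Implicit Types (a b c h s t : R) (f g phi : R -> R) (I : set R).

Definition pos t := Num.max t 0.

Lemma pos_quadratic s t : `|pos s ^+ 2 - pos t ^+ 2 - 2 * pos t * (s - t)| <= (s - t) ^+ 2.
Proof.
have s2 := sqr_ge0 s; have t2 := sqr_ge0 t; have d2 := sqr_ge0 (s - t).
rewrite /pos /Order.max ler_norml.
case: ltP => hs; case: ltP => ht; rewrite ?expr0n /=.
- by apply/andP; split; lra.
- by have st : s * t <= 0 by [nra]; apply/andP; split; nra.
- by have st : s * t <= 0 by [nra]; apply/andP; split; nra.
- by apply/andP; split; nra.
Qed.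

Lemma pos_lipschitz s t : `|pos s - pos t| <= `|s - t|.
Proof.
have h0 := normr_ge0 (s - t); have h1 := ler_norm (s - t).
have h2 := ler_norm (t - s); rewrite distrC in h2.
by rewrite /pos /Order.max; case: ltP => hs; case: ltP => ht;
  rewrite ler_norml; apply/andP; split; lra.
Qed.

(** The quadratic spline that grows from 0 to 1 on the interval from [c] to
    [c + 2 h]; its derivative is the hat function [bump], of integral 1. *)
Definition step c h t :=
  (pos (t - c) ^+ 2 - 2 * pos (t - c - h) ^+ 2 + pos (t - c - 2 * h) ^+ 2) / (2 * h ^+ 2).

Definition bump c h t :=
  (pos (t - c) - 2 * pos (t - c - h) + pos (t - c - 2 * h)) / h ^+ 2.

(** A quadratic bound on the remainder avoids case distinctions at the knots of
    the splines below. *)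
Lemma is_derive_quadratic f t l (C : R) :
  (forall s, `|f s - f t - l * (s - t)| <= C * (s - t) ^+ 2) -> is_derive t 1 f l.
Proof.
move=> H; have C0 : 0 <= C.
  have := le_trans (normr_ge0 _) (H (t + 1)); nra.
have cv : (h^-1 *: ((f \o shift t) (h *: 1) - f t)) @[h --> 0^'] --> l.
  apply/cvgrPdist_le => e e0; near=> h.
  have h0 : h != 0 by near: h; exact: nbhs_dnbhs_neq.
  have hC : `|h| * (C + 1) <= e.
    rewrite -ler_pdivlMr; last lra.
    rewrite -[h]subr0 distrC; near: h.
    by apply: (@cvgr_dist_le _ _ _ (0^') _ id (0:R)); [exact: nbhs_dnbhs|apply: divr_gt0 => //; lra].
  have := H (h + t); rewrite addrK => Hh.
  have -> : l - h^-1 *: ((f \o shift t) (h *: 1) - f t) =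
      - h^-1 * (f (h + t) - f t - l * h).
    rewrite /= [h *: 1]mulr1 /GRing.scale /=; field; exact: h0.
  rewrite normrM normrN normfV ler_pdivrMl ?normr_gt0//.
  apply: (le_trans Hh); rewrite -real_normK ?num_real//.
  have := normr_ge0 h; nra.
split; first by apply/cvg_ex; exists l.
exact/cvg_lim.
Unshelve. all: end_near. Qed.

Lemma step_quadratic c h s t : 0 < h ->
  `|step c h s - step c h t - bump c h t * (s - t)| <= (2 / h ^+ 2) * (s - t) ^+ 2.
Proof.
move=> h0.
have q1 := pos_quadratic (s - c) (t - c).
have q2 := pos_quadratic (s - c - h) (t - c - h).
have q3 := pos_quadratic (s - c - 2 * h) (t - c - 2 * h).
have e1 : s - c - (t - c) = s - t by ring.
have e2 : s - c - h - (t - c - h) = s - t by ring.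
have e3 : s - c - 2 * h - (t - c - 2 * h) = s - t by ring.
rewrite e1 in q1; rewrite e2 in q2; rewrite e3 in q3.
have -> : step c h s - step c h t - bump c h t * (s - t) =
  ((pos (s - c) ^+ 2 - pos (t - c) ^+ 2 - 2 * pos (t - c) * (s - t))
   - 2 * (pos (s - c - h) ^+ 2 - pos (t - c - h) ^+ 2 - 2 * pos (t - c - h) * (s - t))
   + (pos (s - c - 2 * h) ^+ 2 - pos (t - c - 2 * h) ^+ 2
      - 2 * pos (t - c - 2 * h) * (s - t))) / (2 * h ^+ 2).
  by rewrite /step /bump; field; rewrite lt0r_neq0.
have hh : 0 < 2 * h ^+ 2 by rewrite mulr_gt0// exprn_gt0.
rewrite normrM [X in _ * X <= _]ger0_norm; last by rewrite invr_ge0 ltW.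
rewrite ler_pdivrMr//.
have -> : 2 / h ^+ 2 * (s - t) ^+ 2 * (2 * h ^+ 2) = 4 * (s - t) ^+ 2.
  by field; rewrite lt0r_neq0.
move: q1 q2 q3; rewrite !ler_norml => /andP[? ?] /andP[? ?] /andP[? ?].
by apply/andP; split; lra.
Qed.

Lemma step_eq0 c h t : 0 < h -> t <= c -> step c h t = 0.
Proof.
move=> h0 tc; rewrite /step /pos !max_r ?expr0n/=; [by field; rewrite lt0r_neq0|lra..].
Qed.

Lemma step_eq1 c h t : 0 < h -> c + 2 * h <= t -> step c h t = 1.
Proof.
by move=> h0 tc; rewrite /step /pos !max_l; [field; rewrite lt0r_neq0|lra..].
Qed.

Lemma step_itv c h t : 0 < h -> 0 <= step c h t <= 1.
Proof.
move=> h0; have hh : 0 < 2 * h ^+ 2 by rewrite mulr_gt0// exprn_gt0.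
rewrite /step ler_pdivlMr// ler_pdivrMr// mul0r mul1r.
by rewrite /pos /Order.max; do 3 (case: ltP => ?); apply/andP; split; nra.
Qed.

Lemma bump_eq0 c h t : 0 < h -> t <= c \/ c + 2 * h <= t -> bump c h t = 0.
Proof.
move=> h0 [tc|tc]; rewrite /bump /pos.
  by rewrite !max_r; [field; rewrite lt0r_neq0|lra..].
by rewrite !max_l; [field; rewrite lt0r_neq0|lra..].
Qed.

Lemma bump_ge0 c h t : 0 < h -> 0 <= bump c h t.
Proof.
move=> h0; rewrite /bump divr_ge0 ?sqr_ge0//.
by rewrite /pos /Order.max; do 3 (case: ltP => ?); lra.
Qed.

Lemma continuous_bump c h : 0 < h -> continuous (bump c h).
Proof.
move=> h0 t; apply/cvgrPdist_le => e e0.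
have h2 : 0 < h ^+ 2 by exact: exprn_gt0.
near=> s.
have st : `|t - s| <= e * h ^+ 2 / 4.
  near: s; apply: (@cvgr_dist_le _ _ _ (nbhs t) _ id t) => //.
  by rewrite divr_gt0// mulr_gt0.
have p1 := pos_lipschitz (t - c) (s - c).
have p2 := pos_lipschitz (t - c - h) (s - c - h).
have p3 := pos_lipschitz (t - c - 2 * h) (s - c - 2 * h).
have e1 : t - c - (s - c) = t - s by ring.
have e2 : t - c - h - (s - c - h) = t - s by ring.
have e3 : t - c - 2 * h - (s - c - 2 * h) = t - s by ring.
rewrite e1 in p1; rewrite e2 in p2; rewrite e3 in p3.
rewrite /bump -mulrBl normrM [X in _ * X]ger0_norm; last by rewrite invr_ge0 ltW.
rewrite ler_pdivrMr//.
move: (le_trans p1 st) (le_trans p2 st) (le_trans p3 st).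
rewrite !ler_norml => /andP[? ?] /andP[? ?] /andP[? ?].
by apply/andP; split; lra.
Unshelve. all: end_near. Qed.

Lemma is_derive_step c h t : 0 < h -> is_derive t 1 (step c h) (bump c h t).
Proof.
by move=> h0; apply: (@is_derive_quadratic _ _ _ (2 / h ^+ 2)) => s; exact: step_quadratic.
Qed.

Lemma derivable_continuous f x : derivable f x 1 -> {for x, continuous f}.
Proof. by move=> /derivable1_diffP/differentiable_continuous. Qed.

Lemma int_bump c h : 0 < h -> (\int[mu]_(x in `[c, (c + 2 * h)%R]) (bump c h x)%:E)%E = 1%E.
Proof.
move=> h0; have cc : c < c + 2 * h by lra.
have dS x : derivable (step c h) x 1 by have [] := is_derive_step c x h0.
have cS x : {for x, continuous (step c h)} by exact: derivable_continuous.
rewrite (@continuous_FTC2 _ _ (step c h))//.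
- by rewrite step_eq1// step_eq0// sube0.
- apply: continuous_subspaceT; exact: continuous_bump.
- by split => [x _||]; [|apply: cvg_at_right_filter; exact: cS|apply: cvg_at_left_filter; exact: cS].
- by move=> x _; rewrite derive1E; have [_ ->] := is_derive_step c x h0.
Qed.

(** A test function supported in the open interval from [a] to [b] which tends to
    its indicator function as [h] tends to 0, while its derivative tends to the
    difference of the Dirac masses at [a] and [b]. *)
Definition trapezoid a b h t := step (a + h) h t - step (b - 3 * h) h t.

Lemma is_derive_trapezoid a b h t : 0 < h ->
  is_derive t 1 (trapezoid a b h) (bump (a + h) h t - bump (b - 3 * h) h t).
Proof.
move=> h0; apply: (@is_derive_quadratic _ _ _ (4 / h ^+ 2)) => s.
have s1 := step_quadratic (a + h) s t h0.
have s2 := step_quadratic (b - 3 * h) s t h0.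
rewrite /trapezoid.
move: s1 s2; rewrite !ler_norml => /andP[? ?] /andP[? ?].
by apply/andP; split; lra.
Qed.

Lemma trapezoid_test I a b h : 0 < h -> 6 * h <= b - a -> `]a, b[ `<=` I ->
  C1_compact_support I (trapezoid a b h).
Proof.
move=> h0 hab abI; split.
- by move=> t; have [] := is_derive_trapezoid a b t h0.
- rewrite (_ : derive1 _ = fun t => bump (a + h) h t - bump (b - 3 * h) h t).
    by move=> t; apply: cvgB; exact: continuous_bump.
  by apply/funext => t; rewrite derive1E; have [_ ->] := is_derive_trapezoid a b t h0.
- exists `[a + h, b - h]%classic; split.
  + exact: segment_compact.
  + apply: (@subset_trans _ `]a, b[%classic).
      by move=> x /=; rewrite !in_itv/= => /andP[? ?]; apply/andP; split; lra.
    by rewrite -open_subsetE//; exact: interval_open.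
  + move=> x; rewrite /= in_itv/= => /negP; rewrite negb_and -!ltNge => /orP[xa|xb].
      by rewrite /trapezoid !step_eq0//; lra.
    by rewrite /trapezoid !step_eq1//; lra.
Qed.

Lemma trapezoid_itv a b h t : 0 < h -> 6 * h <= b - a -> 0 <= trapezoid a b h t <= 1.
Proof.
move=> h0 hab; rewrite /trapezoid.
have /andP[s0 s1] := step_itv (a + h) t h0.
have /andP[u0 u1] := step_itv (b - 3 * h) t h0.
have [tc|tc] := leP t (b - 3 * h).
  by rewrite [step (b - _) _ _]step_eq0//; apply/andP; split; lra.
rewrite [step (a + h) _ _]step_eq1//; last lra.
by apply/andP; split; lra.
Qed.

Lemma trapezoid_eq0 a b h t : 0 < h -> 6 * h <= b - a -> t < a \/ b < t -> trapezoid a b h t = 0.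
Proof.
move=> h0 hab [ta|tb]; rewrite /trapezoid.
  by rewrite !step_eq0//; lra.
by rewrite !step_eq1//; lra.
Qed.

Lemma trapezoid_eq1 a b h t : 0 < h -> a + 3 * h <= t <= b - 3 * h -> trapezoid a b h t = 1.
Proof.
by move=> h0 /andP[ta tb]; rewrite /trapezoid step_eq1 ?step_eq0//; lra.
Qed.

End test_functions.

(** * Weak derivatives on an interval *)

Section weak_derivatives.
Context {R : realType}.
Local Notation mu := (@lebesgue_measure R).
Local Notation mset I := (@measurable _ (measurableTypeR R) I).
Local Notation integ I f := (mu.-integrable I (EFin \o f)).
Local Notation int I f := (Rintegral mu I f).
Implicit Types (a b c e h s t y : R) (f g phi : R -> R) (I K : set R).

Lemma continuous_support_integ I f K : mset I -> continuous f -> compact K ->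
  (forall x, ~ K x -> f x = 0) -> integ I f.
Proof.
move=> mI cf cK fK; apply: (@integrableS _ _ _ _ setT) => //.
have mK : mset K by exact: compact_measurable.
have : integ K f.
  by apply: continuous_compact_integrable => //; exact: continuous_subspaceT.
move=> iK; have := (@integrable_mkcond _ _ _ mu K _ mK).1 iK; apply: eq_integrable => // x _.
rewrite restrict_EFin /= patchE; have [//|xK] := boolP (x \in K).
by rewrite fK// => Kx; move: xK; rewrite mem_set.
Qed.

Lemma continuous_support_sqint I f K : mset I -> continuous f -> compact K ->
  (forall x, ~ K x -> f x = 0) -> sqint mu I f.
Proof.
move=> mI cf cK fK; split.
  by apply: (@measurable_funS _ _ _ _ setT) => //; exact: continuous_measurable_fun.
apply: (continuous_support_integ mI _ cK).
  by move=> x; exact: continuousM (cf x) (cf x).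
by move=> x /fK ->; rewrite expr0n.
Qed.

(** The derivative also vanishes off the compact support: the complement of the
    support is open, so that the function is locally zero there. *)
Lemma test_sqint I phi : mset I -> C1_compact_support I phi ->
  [/\ sqint mu I phi, sqint mu I (derive1 phi) & integ I (fun x => `|derive1 phi x|)].
Proof.
move=> mI [dphi cphi' [K [cK _ phi0]]].
have cphi : continuous phi by move=> x; exact: derivable_continuous.
have phi'0 x : ~ K x -> derive1 phi x = 0.
  move=> Kx; rewrite derive1E -(@derive_cst _ R R 0 x 1).
  apply: near_eq_derive.
  have oK : open (~` K) by apply: closed_openC; apply: compact_closed => //; exact: norm_hausdorff.
  have : nbhs x (~` K) by exact: open_nbhs_nbhs.
  by apply: filterS => y /= Ky; rewrite phi0.
split; [exact: continuous_support_sqint phi0|exact: continuous_support_sqint phi'0|].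
apply: (continuous_support_integ mI _ cK) => [x|x /phi'0 ->]; last by rewrite normr0.
by apply: continuous_comp => //; [exact: cphi'|exact: norm_continuous].
Qed.

Definition rweak I f g := forall phi, C1_compact_support I phi ->
  int I (fun x => f x * derive1 phi x) = - int I (fun x => g x * phi x).

Lemma bump_sqint I c h : mset I -> 0 < h -> sqint mu I (bump c h).
Proof.
move=> mI h0; apply: (continuous_support_sqint mI (continuous_bump h0)
  (@segment_compact _ c (c + 2 * h))).
move=> x; rewrite /= in_itv/= => /negP; rewrite negb_and -!ltNge => xc.
by apply: bump_eq0 => //; case/orP: xc => ?; [left|right]; lra.
Qed.

Lemma int_bump_on I c h : mset I -> 0 < h -> `[c, c + 2 * h] `<=` I ->
  integ I (bump c h) /\ int I (bump c h) = 1.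
Proof.
move=> mI h0 cI.
have z x : ~ `[c, c + 2 * h]%classic x -> bump c h x = 0.
  rewrite /= in_itv/= => /negP; rewrite negb_and -!ltNge => xc.
  by apply: bump_eq0 => //; case/orP: xc => ?; [left|right]; lra.
split.
  apply: (continuous_support_integ mI (continuous_bump h0)
    (@segment_compact _ c (c + 2 * h))) z.
transitivity (int `[c, (c + 2 * h)%R] (bump c h)); last by rewrite /Rintegral int_bump.
rewrite -[in RHS](setIidr cI) Rintegral_mkcondr; apply: eq_Rintegral => x _.
rewrite patchE; have [//|xc] := boolP (x \in _).
by apply: (z x) => Kx; move: xc; rewrite mem_set.
Qed.

(** The integral against [bump c h] is an average of [f] on a short interval. *)
Lemma int_bump_approx I f c h y e : mset I -> 0 < h -> `[c, c + 2 * h] `<=` I ->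
  sqint mu I f -> (forall t, c <= t <= c + 2 * h -> `|f t - y| <= e) ->
  `|int I (fun x => f x * bump c h x) - y| <= e.
Proof.
move=> mI h0 cI fL fe; have [iB B1] := int_bump_on mI h0 cI.
have ifB := sqint_mul mI fL (bump_sqint c mI h0).
have -> : int I (fun x => f x * bump c h x) - y =
    int I (fun x => f x * bump c h x - y * bump c h x).
  by rewrite (RintegralB mI ifB (integZ mI y iB)) RintegralZl// B1 mulr1.
apply: le_trans (le_normr_Rintegral mI (integB mI ifB (integZ mI y iB))) _.
rewrite -[leRHS]mulr1 -B1 -RintegralZl//; apply: le_Rintegral => //.
- by apply: integrable_norm; exact: (integB mI ifB (integZ mI y iB)).
- exact: integZ.
move=> x _; rewrite -/(bump c h x) -mulrBl normrM [X in _ * X]ger0_norm ?bump_ge0//.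
have [xc|xc] := boolP (c <= x <= c + 2 * h).
  by rewrite ler_wpM2r ?bump_ge0// fe.
have -> : bump c h x = 0; last by rewrite !mulr0.
apply: bump_eq0 => //.
by move: xc; rewrite negb_and -!ltNge => /orP[?|?]; [left|right]; lra.
Qed.

Lemma int_indic_itv I a b : mset I -> a <= b -> `[a, b] `<=` I ->
  integ I (\1_(`[a, b]) : R -> R) /\ int I (\1_(`[a, b]) : R -> R) = b - a.
Proof.
move=> mI ab abI; split.
  apply: (@integrableS _ _ _ _ setT) => //.
  exact: integrable_indic_itv.
rewrite /Rintegral integral_indic//; rewrite (setIidl abI) /= lebesgue_measure_itv/= lte_fin.
have [//|ba] := ltP a b.
by rewrite /= (_ : b - a = 0)//; lra.
Qed.

Lemma trapezoid_sqint I a b h : mset I -> 0 < h -> 6 * h <= b - a ->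
  `[a, b] `<=` I -> sqint mu I (trapezoid a b h).
Proof.
move=> mI h0 hab abI; have [] // := @test_sqint I (trapezoid a b h) mI.
apply: trapezoid_test => //; apply: subset_trans abI.
exact: subset_itv_oo_cc.
Qed.

Lemma int_trapezoid_sqr I a b h : mset I -> 0 < h -> 6 * h <= b - a ->
  `[a, b] `<=` I -> int I (fun x => trapezoid a b h x ^+ 2) <= b - a.
Proof.
move=> mI h0 hab abI; have ab : a <= b by lra.
have [i1 <-] := int_indic_itv mI ab abI.
apply: le_Rintegral => //; first exact: (trapezoid_sqint mI h0 hab abI).2.
move=> x _; have /andP[t0 t1] := trapezoid_itv x h0 hab.
change (trapezoid a b h x ^+ 2 <= (x \in `[a, b]%classic)%:R).
have [xab|] := boolP (x \in _); first by rewrite /=; nra.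
rewrite notin_setE/= in_itv/= => /negP; rewrite negb_and -!ltNge => xc.
rewrite trapezoid_eq0 ?expr0n//; case/orP: xc; tauto.
Qed.

(** Testing the weak derivative against [trapezoid a b h] and letting h tend to 0
    yields f b - f a on one side; the other side is at most the integral of |g|
    on the interval, and the Cauchy-Schwarz inequality concludes.  The ramps lie
    inside the interval, so that endpoints of the edge are allowed. *)
Lemma weak_derivative_hoelder I f g a b : mset I -> a < b -> `[a, b] `<=` I ->
  {within I, continuous f} -> sqint mu I f -> sqint mu I g -> rweak I f g ->
  (f b - f a) ^+ 2 <= (b - a) * int I (fun x => g x ^+ 2).
Proof.
move=> mI ab abI cf fL gL fg.
have {}cf : {within `[a, b], continuous f} by exact: continuous_subspaceW cf.
have [_ fa fb] := (continuous_within_itvP f ab).1 cf.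
set G := int I _; have G0 : 0 <= G by exact: int_sqr_ge0.
suff H : `|f b - f a| <= Num.sqrt ((b - a) * G).
  rewrite -(real_normK (num_real _)) -[leRHS]sqr_sqrtr; last by rewrite mulr_ge0//; lra.
  by rewrite ler_pXn2r ?nnegrE ?sqrtr_ge0.
apply/ler_addgt0Pr => e e0; have e2 : 0 < e / 2 by lra.
move/cvgrPdist_le: fa => /(_ _ e2)[da /= da0 Ha].
move/cvgrPdist_le: fb => /(_ _ e2)[db /= db0 Hb].
(* both ramps lie within the distance where [f] is almost constant *)
pose h := Num.min (da / 4) (Num.min (db / 4) ((b - a) / 6)).
have h0 : 0 < h by rewrite /h !lt_min; apply/and3P; split; lra.
have hda : h <= da / 4 by rewrite /h ge_min lexx.
have hdb : h <= db / 4 by rewrite /h !ge_min lexx orbT.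
have hab : 6 * h <= b - a.
  by rewrite mulrC -ler_pdivlMr// /h !ge_min lexx !orbT.
have iA : `|int I (fun x => f x * bump (a + h) h x) - f a| <= e / 2.
  apply: int_bump_approx => //.
    apply: subset_trans abI => x /=; rewrite !in_itv/= => /andP[? ?].
    by apply/andP; split; lra.
  move=> t /andP[t1 t2]; rewrite distrC; apply: Ha => /=; last lra.
  by rewrite distrC ger0_norm; lra.
have iB : `|int I (fun x => f x * bump (b - 3 * h) h x) - f b| <= e / 2.
  apply: int_bump_approx => //.
    apply: subset_trans abI => x /=; rewrite !in_itv/= => /andP[? ?].
    by apply/andP; split; lra.
  move=> t /andP[t1 t2]; rewrite distrC; apply: Hb => /=; last lra.
  by rewrite ger0_norm; lra.
have abI' : `]a, b[ `<=` I by apply: subset_trans abI; exact: subset_itv_oo_cc.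
have E := fg _ (trapezoid_test h0 hab abI').
have E' : int I (fun x => f x * derive1 (trapezoid a b h) x) =
    int I (fun x => f x * bump (a + h) h x) - int I (fun x => f x * bump (b - 3 * h) h x).
  rewrite -RintegralB//; [|exact: sqint_mul fL (bump_sqint _ mI h0)..].
  apply: eq_Rintegral => x _; rewrite derive1E.
  by have [_ ->] := is_derive_trapezoid a b x h0; ring.
rewrite {}E' in E.
have C : `|int I (fun x => g x * trapezoid a b h x)| <= Num.sqrt ((b - a) * G).
  rewrite -ler_sqr ?nnegrE ?sqrtr_ge0// sqr_sqrtr; last by rewrite mulr_ge0//; lra.
  rewrite real_normK ?num_real//.
  apply: le_trans (cauchy_schwarz mI gL (trapezoid_sqint mI h0 hab abI)) _.
  rewrite mulrC ler_wpM2r//; exact: int_trapezoid_sqr.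
move: E C iA iB; set A := int I _; set B := int I _; set F := int I _; move=> E.
rewrite !ler_norml => /andP[? ?] /andP[? ?] /andP[? ?]; apply/andP; split; lra.
Qed.

End weak_derivatives.

(** * Uniqueness of weak derivatives *)

Section weak_derivative_uniqueness.
Context {R : realType}.
Local Notation mu := (@lebesgue_measure R).
Local Notation mset I := (@measurable _ (measurableTypeR R) I).
Local Notation integ I f := (mu.-integrable I (EFin \o f)).
Local Notation int I f := (Rintegral mu I f).
Implicit Types (a b c e h s t y : R) (f g phi : R -> R) (I K : set R).

Definition ind a b : R -> R := fun x => (x \in `[a, b]%classic)%:R.

Lemma ind_sqint I a b : mset I -> a <= b -> `[a, b] `<=` I ->
  [/\ sqint mu I (ind a b), integ I (ind a b) & int I (ind a b) = b - a].
Proof.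
move=> mI ab abI; have [i1 i2] := int_indic_itv mI ab abI; split => //; split.
  exact: integ_mfun i1.
apply: (eq_integ mI _ i1) => x _.
change ((x \in `[a, b]%classic)%:R = (x \in `[a, b]%classic)%:R ^+ 2 :> R).
by case: (x \in _); rewrite ?expr1n ?expr0n.
Qed.

(** The indicator function of an interval is at L^2 distance at most
    sqrt (6 h) from the trapezoid, which is a test function. *)
Lemma int_itv_eq0 I g a b : mset I -> a < b -> `[a, b] `<=` I -> sqint mu I g ->
  (forall phi, C1_compact_support I phi -> int I (fun x => g x * phi x) = 0) ->
  int I (fun x => g x * ind a b x) = 0.
Proof.
move=> mI ab abI gL g0; set X := int I _.
set G := int I (fun x => g x ^+ 2); have G0 : 0 <= G by exact: int_sqr_ge0.
have [iL _ _] := ind_sqint mI (ltW ab) abI.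
have key h : 0 < h -> 6 * h <= b - a -> X ^+ 2 <= G * (6 * h).
  move=> h0 hab; have tL := trapezoid_sqint mI h0 hab abI.
  have dL := sqint_sub mI iL tL.
  have -> : X = int I (fun x => g x * (ind a b x - trapezoid a b h x)).
    rewrite -[X]subr0 -(g0 (trapezoid a b h)); last first.
      by apply: trapezoid_test => //; apply: subset_trans abI; exact: subset_itv_oo_cc.
    rewrite -(RintegralB mI (sqint_mul mI gL iL) (sqint_mul mI gL tL)).
    by apply: eq_Rintegral => x _; ring.
  apply: le_trans (cauchy_schwarz mI gL dL) _; rewrite ler_wpM2l//.
  have [_ i1 e1] : [/\ sqint mu I (ind a (a + 3 * h)), integ I (ind a (a + 3 * h)) &
      int I (ind a (a + 3 * h)) = (a + 3 * h) - a].
    apply: ind_sqint => //; first lra.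
    apply: subset_trans abI => x /=; rewrite !in_itv/= => /andP[? ?].
    by apply/andP; split; lra.
  have [_ i2 e2] : [/\ sqint mu I (ind (b - 3 * h) b), integ I (ind (b - 3 * h) b) &
      int I (ind (b - 3 * h) b) = b - (b - 3 * h)].
    apply: ind_sqint => //; first lra.
    apply: subset_trans abI => x /=; rewrite !in_itv/= => /andP[? ?].
    by apply/andP; split; lra.
  have -> : 6 * h = int I (ind a (a + 3 * h)) + int I (ind (b - 3 * h) b).
    by rewrite e1 e2; ring.
  rewrite -(RintegralD mI i1 i2); apply: le_Rintegral => //.
  - exact: dL.2.
  - exact: integD.
  move=> x _; have /andP[t0 t1] := trapezoid_itv x h0 hab.
  rewrite /ind !mem_setE !in_itv/=.
  have [xa|xa] := leP a x; last first.
    rewrite trapezoid_eq0//; last by left.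
    by rewrite (_ : b - 3 * h <= x = false) /= ?subrr ?expr0n ?addr0//; apply/negbTE; rewrite -ltNge; lra.
  have [xb|xb] := leP x b; last first.
    rewrite trapezoid_eq0//; last by right.
    by rewrite (_ : x <= a + 3 * h = false) /= ?andbF ?subrr ?expr0n ?addr0//; apply/negbTE; rewrite -ltNge; lra.
  have [x1|x1] := leP x (a + 3 * h); have [x2|x2] := leP (b - 3 * h) x => /=; try nra.
  by rewrite trapezoid_eq1 ?(ltW x1) ?(ltW x2)// subrr expr0n addr0.
have : X ^+ 2 <= 0.
  apply/ler_addgt0Pr => e e0; rewrite add0r.
  pose h := Num.min ((b - a) / 6) (e / (6 * (G + 1))).
  have h0 : 0 < h.
    rewrite lt_min; apply/andP; split; first lra.
    by rewrite divr_gt0// mulr_gt0//; lra.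
  have h1 : 6 * h <= b - a by rewrite mulrC -ler_pdivlMr// ge_min lexx.
  have h2 : h * (6 * (G + 1)) <= e.
    by rewrite -ler_pdivlMr ?ge_min ?lexx ?orbT// mulr_gt0//; lra.
  have := key h h0 h1; nra.
by move=> X2; apply/eqP; rewrite -sqrf_eq0 eq_le X2 sqr_ge0.
Qed.

Lemma sqint_locally_integrable I g : mset I -> sqint mu I g ->
  locally_integrable setT (g \_ I).
Proof.
move=> mI [mg ig]; split; first exact/(measurable_restrictT _ mI).
  exact: openT.
move=> K _ cK; have mK : mset K by exact: compact_measurable.
have i1 : integ K (cst 1).
  apply: continuous_compact_integrable => //.
  by apply: continuous_subspaceT => x; exact: cvg_cst.
have i2 : integ K (fun x => (g \_ I) x ^+ 2).
  apply: (@integrableS _ _ _ mu setT) => //.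
  have := (@integrable_mkcond _ _ _ mu I _ mI).1 ig.
  apply: eq_integrable => // x _; rewrite /= restrict_EFin /= !patchE.
  by case: ifP => _ //; rewrite expr0n.
have mr : measurable_fun K (g \_ I).
  apply: (@measurable_funS _ _ _ _ setT) => //.
  exact/(measurable_restrictT _ mI).
have : integ K (g \_ I).
  apply: (integ_le mK mr (integD mK i1 i2)) => x _.
  rewrite -[X in _ + X]real_normK ?num_real//.
  have := normr_ge0 ((g \_ I) x); rewrite /cst; nra.
by move=> /integrableP[].
Qed.

Lemma nicely_shrinking_ball x : nicely_shrinking x (fun n => ball x (n.+1%:R^-1 : R)).
Proof.
split; first by move=> n; exact: measurable_ball.
exists (1, fun n => (n.+1%:R^-1 : R)%:pos); split => //=.
- exact: cvg_harmonic.
- by move=> n y.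
- by move=> n /=; rewrite mul1e.
Qed.

(** Integrals of [g] over small balls vanish, so [g] vanishes at each of its
    Lebesgue points in the interior. *)
Lemma weak_derivative_unique I g : mset I -> mu (I `\` I°) = 0%E ->
  (forall x, I° x -> exists2 e, 0 < e & `[x - e, x + e] `<=` I) ->
  sqint mu I g ->
  (forall phi, C1_compact_support I phi -> int I (fun x => g x * phi x) = 0) ->
  {ae mu, forall x, I x -> g x = 0}.
Proof.
move=> mI I0 Io gL g0.
have lg := sqint_locally_integrable mI gL.
have H1 := lebesgue_differentiation lg.
have H2 : {ae mu, forall x, ~ (I `\` I°) x}.
  exists (I `\` I°); split => //; last by move=> x /= /contrapT.
  apply: measurableD => //; exact: open_measurable (open_interior _).
have FF := ae_filter_ringOfSetsType mu.
apply: (@filterS2 _ _ FF _ _ _ _ H1 H2) => x xl xI Ix.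
have Ixo : I° x by apply: contrapT => h; apply: xI.
have [e e0 xe] := Io _ Ixo.
have := nice_lebesgue_differentiation nicely_shrinking_ball lg xl.
have cx : (fun n => ((lebesgue_measure (ball x (n.+1%:R^-1 : R)))^-1 *
    \int[lebesgue_measure]_(y in ball x (n.+1%:R^-1 : R)) ((g \_ I) y)%:E)%E) @ \oo --> 0%E.
  apply: cvg_near_cst; near=> n.
  have ne : (n.+1%:R^-1 : R) <= e.
    rewrite invf_ple ?posrE//; apply: le_trans (_ : n%:R <= _).
      near: n; exact: nbhs_infty_ger.
    by rewrite ler_nat.
  have n0 : 0 < (n.+1%:R^-1 : R) by rewrite invr_gt0.
  set r := n.+1%:R^-1 in ne n0 *.
  have abI : `[x - r, x + r] `<=` I.
    apply: subset_trans xe => y /=; rewrite !in_itv/= => /andP[? ?].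
    by apply/andP; split; lra.
  have ab : x - r < x + r by lra.
  have Z := int_itv_eq0 mI ab abI gL g0.
  have [iL _ _] := ind_sqint mI (ltW ab) abI.
  have iZ := sqint_mul mI gL iL.
  have ZE : (\int[mu]_(y in I) (g y * ind (x - r) (x + r) y)%:E = 0)%E.
    by rewrite -(intE mI iZ) Z.
  suff -> : (\int[mu]_(y in ball x r) ((g \_ I) y)%:E = 0)%E by rewrite mule0.
  have [mgI _ _] := lg.
  have mgI' J : mset J -> measurable_fun J (fun y => ((g \_ I) y)%:E).
    move=> mJ; apply/measurable_EFinP; exact: measurable_funS mgI.
  rewrite -ZE ball_itv integral_itv_bndo_bndc; last exact: mgI'.
  rewrite integral_itv_obnd_cbnd; last exact: mgI'.
  rewrite integral_mkcond [RHS]integral_mkcond; apply: eq_integral => y _.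
  rewrite !patchE /ind.
  by case: (y \in `[x - r, x + r]%classic); case: (y \in I); rewrite ?mulr1 ?mulr0.
move=> c2; have := cvg_lim (@ereal_hausdorff R) c2.
rewrite (cvg_lim (@ereal_hausdorff R) cx) patchE mem_set// => /(_ _)[] //.
Unshelve. all: end_near. Qed.

End weak_derivative_uniqueness.

(** * Extraction of pointwise convergent sequences *)

Section extraction.
Context {R : realType}.
Implicit Types (e x y M K : R).

(** Limits along an ultrafilter exist for all points at once; this replaces a
    diagonal extraction. *)
Lemma ultra_bounded_lim (U : set_system nat) (u : R^nat) M : UltraFilter U ->
  (forall n, `|u n| <= M) -> exists l, forall e, 0 < e -> U [set n | `|u n - l| <= e].
Proof.
move=> UU uM.
have PF : ProperFilter U by exact: ultra_proper.
have FU : ProperFilter (u @ U) by exact: fmap_proper_filter.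
have uU : (u @ U) `[- M, M]%classic.
  apply: (@filterE _ U) => n; rewrite /= in_itv/= -ler_norml; exact: uM.
have [l [_ lc]] := @segment_compact R (- M) M (u @ U) FU uU.
exists l => e e0; have [//|cU] := in_ultra_setVsetC [set n | `|u n - l| <= e] UU.
have nl : nbhs l (ball l e) by exact: nbhsx_ballx.
have cU' : (u @ U) (~` ball l e).
  change (U (u @^-1` (~` ball l e))); apply: filterS cU => n /= h.
  move=> lu; apply: h => /=.
  by rewrite distrC ltW.
by have [x []] := lc _ _ cU' nl.
Qed.

(** Limits along an ultrafilter define the limit functions; the sequence is then
    chosen so that its k-th term is close to the limit on a grid of mesh
    1 / (k + 1) in the interval from 0 to k.  Equicontinuity extends the
    convergence from the grids to all points. *)
Lemma pointwise_extraction (J : finType) (I : J -> set R) (f : nat -> J -> R -> R) M K :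
  0 <= K -> (forall j x, I j x -> 0 <= x) ->
  (forall j x y, I j x -> 0 <= y <= x -> I j y) ->
  (forall n j x, I j x -> `|f n j x| <= M) ->
  (forall n j x y, I j x -> I j y -> (f n j x - f n j y) ^+ 2 <= `|x - y| * K) ->
  exists (s : nat -> nat) (g : J -> R -> R),
    [/\ forall k, (k <= s k)%N,
      forall j x, I j x -> f (s k) j x @[k --> \oo] --> g j x,
      forall j x, I j x -> `|g j x| <= M &
      forall j x y, I j x -> I j y -> (g j x - g j y) ^+ 2 <= `|x - y| * K].
Proof.
move=> Ka I0 Idown fM fK.
have [U [UU Uoo]] := ultraFilterLemma (eventually_filter : ProperFilter \oo).
have PF : ProperFilter U by exact: ultra_proper.
have ex j x : exists l, I j x -> forall e, 0 < e -> U [set n | `|f n j x - l| <= e].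
  have [Ix|Ix] := pselect (I j x); last by exists 0.
  by have [l Hl] := ultra_bounded_lim UU (fun n => fM n j x Ix); exists l.
pose g j x := projT1 (cid (ex j x)).
have gP j x : I j x -> forall e, 0 < e -> U [set n | `|f n j x - g j x| <= e].
  by rewrite /g; case: cid.
have gM j x : I j x -> `|g j x| <= M.
  move=> Ix; apply/ler_addgt0Pr => e e0.
  have [n /= Hn] := filter_ex (gP j x Ix e e0).
  have := fM n j x Ix; move: Hn; rewrite !ler_norml => /andP[? ?] /andP[? ?].
  by apply/andP; split; lra.
have gK j x y : I j x -> I j y -> (g j x - g j y) ^+ 2 <= `|x - y| * K.
  move=> Ix Iy; have k0 : 0 <= `|x - y| * K by exact: mulr_ge0.
  rewrite -(real_normK (num_real _)) -[leRHS]sqr_sqrtr//.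
  rewrite ler_pXn2r ?nnegrE ?sqrtr_ge0//.
  apply/ler_addgt0Pr => e e0; have e2 : 0 < e / 2 by lra.
  have [n /= [H1 H2]] := filter_ex (filterI (gP j x Ix _ e2) (gP j y Iy _ e2)).
  have H3 : `|f n j x - f n j y| <= Num.sqrt (`|x - y| * K).
    rewrite -(@ler_pXn2r _ 2) ?nnegrE ?sqrtr_ge0// sqr_sqrtr// real_normK ?num_real//.
    exact: fK.
  move: H1 H2 H3; rewrite !ler_norml => /andP[? ?] /andP[? ?] /andP[? ?].
  by apply/andP; split; lra.
(* (k + 1)^2 grid points cover the interval from 0 to k *)
have exs k : exists n, (k <= n)%N /\ forall j (i : 'I_(k.+1 ^ 2)),
    I j (i%:R / k.+1%:R) -> `|f n j (i%:R / k.+1%:R) - g j (i%:R / k.+1%:R)| <= k.+1%:R^-1.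
  have U1 : U [set n | (k <= n)%N] by apply: Uoo; exact: nbhs_infty_ge.
  have U2 : U [set n | forall j (i : 'I_(k.+1 ^ 2)),
      I j (i%:R / k.+1%:R) -> `|f n j (i%:R / k.+1%:R) - g j (i%:R / k.+1%:R)| <= k.+1%:R^-1].
    apply: filter_forall => j; apply: filter_forall => i.
    have [Ii|Ii] := pselect (I j (i%:R / k.+1%:R)); last by apply: filterE.
    have := gP j _ Ii k.+1%:R^-1; rewrite invr_gt0 ltr0n => /(_ erefl).
    by apply: filterS.
  by have [n /= [? ?]] := filter_ex (filterI U1 U2); exists n.
pose s k := projT1 (cid (exs k)).
have sP k : (k <= s k)%N /\ forall j (i : 'I_(k.+1 ^ 2)),
    I j (i%:R / k.+1%:R) ->
    `|f (s k) j (i%:R / k.+1%:R) - g j (i%:R / k.+1%:R)| <= k.+1%:R^-1.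
  by rewrite /s; case: cid.
exists s, g; split => //; first by move=> k; have [] := sP k.
move=> j x Ix; apply/cvgrPdist_le => e e0; near=> k.
have x0 := I0 _ _ Ix.
have k0 : 0 < k.+1%:R :> R by rewrite ltr0n.
have xk : x <= k%:R by near: k; exact: nbhs_infty_ger.
have e3 : 0 < e / 3 by lra.
have c1 : k.+1%:R^-1 <= e / 3.
  rewrite invf_ple ?posrE//; apply: le_trans (_ : k%:R <= _); last by rewrite ler_nat.
  by near: k; exact: nbhs_infty_ger.
have c2 : k.+1%:R^-1 * K <= (e / 3) ^+ 2.
  rewrite mulrC ler_pdivrMr// mulrC -ler_pdivrMr ?exprn_gt0//.
  apply: le_trans (_ : k%:R <= _); last by rewrite ler_nat.
  by near: k; exact: nbhs_infty_ger.
pose i := Num.truncn (x * k.+1%:R).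
have /andP[i1 i2] := truncn_itv (mulr_ge0 x0 (ltW k0)).
have ib : (i < k.+1 ^ 2)%N.
  rewrite /i truncn_lt_nat; last by rewrite mulr_ge0// ltW.
  rewrite natrX expr2 ltr_pM2r//; apply: (le_lt_trans xk).
  by rewrite ltr_nat.
pose y := i%:R / k.+1%:R : R.
have yx : 0 <= y <= x.
  rewrite /y divr_ge0//= ?ler0n// ler_pdivrMr//.
have Iy : I j y by exact: Idown Ix yx.
have xy : `|x - y| <= k.+1%:R^-1.
  have /andP[_ yx2] := yx.
  rewrite ger0_norm ?subr_ge0// lerBlDr /y -[X in X + _]mul1r -mulrDl.
  by rewrite ler_pdivlMr// addrC natr1 ltW.
have small a : a ^+ 2 <= `|x - y| * K -> `|a| <= e / 3.
  move=> ha; rewrite -(@ler_pXn2r _ 2) ?nnegrE//; last exact: ltW.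
  rewrite real_normK ?num_real//; apply: (le_trans ha).
  by apply: le_trans c2; rewrite ler_wpM2r.
have h1 := small _ (fK (s k) j x y Ix Iy).
have h2 := small _ (gK j x y Ix Iy).
have h3 := (sP k).2 j (Ordinal ib) Iy.
have {}h3 := le_trans h3 c1.
move: h1 h2 h3; rewrite -/y !ler_norml => /andP[? ?] /andP[? ?] /andP[? ?].
by apply/andP; split; lra.
Unshelve. all: end_near. Qed.

End extraction.

(** * Limits of weak derivatives and supremum bounds *)

Section dominated_convergence_real.
Context d {T : measurableType d} {R : realType}.
Variables (mu : {measure set T -> \bar R}) (D : set T) (mD : measurable D).
Implicit Types f g : T -> R.
Local Notation integ f := (mu.-integrable D (EFin \o f)).
Local Notation int f := (Rintegral mu D f).

Lemma dominated_cvg_real (f_ : (T -> R)^nat) f g :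
  (forall n, measurable_fun D (f_ n)) ->
  (forall x, D x -> f_ ^~ x @ \oo --> f x) ->
  integ g -> (forall n x, D x -> `|f_ n x| <= g x) ->
  int (f_ n) @[n --> \oo] --> int f.
Proof.
move=> mf ff ig fg.
have mf' : measurable_fun D f by exact: measurable_fun_cvg mf ff.
have fn n : integ (f_ n) by exact: integ_le (fg n).
have fi : integ f.
  apply: (integ_le mD mf' ig) => x Dx.
  have /cvg_lim <-// : `|f_ n x| @[n --> \oo] --> `|f x| by apply: cvg_norm; exact: ff.
  apply: limr_le; first by apply: is_cvg_norm; apply/cvg_ex; exists (f x); exact: ff.
  by apply: nearW => n; exact: fg.
have H1 n : measurable_fun D (EFin \o f_ n) by exact/measurable_EFinP.
have H2 x : D x -> (EFin \o f_ n) x @[n --> \oo] --> (EFin \o f) x.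
  by move=> Dx; apply/cvg_EFin; [exact: nearW|exact: ff].
have H3 n x : D x -> (`|(EFin \o f_ n) x| <= (EFin \o g) x)%E.
  by move=> Dx; rewrite lee_fin fg.
have H4 x : D x -> (EFin \o g) x \is a fin_num by [].
have := dominated_cvg mD H1 H2 H4 ig H3.
rewrite -(intE mD fi) => cE.
by have /fine_cvgP[_] := cE.
Qed.

Lemma ae_eq_int f g : measurable_fun D f -> measurable_fun D g ->
  {ae mu, forall x, D x -> f x = g x} -> int f = int g.
Proof.
move=> mf mg fg; congr fine; apply: ae_eq_integral => //.
- exact/measurable_EFinP.
- exact/measurable_EFinP.
- by apply: filterS fg => x h Dx; rewrite h.
Qed.

End dominated_convergence_real.

Section sobolev_interval.
Context {R : realType}.
Local Notation mu := (@lebesgue_measure R).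
Local Notation mset I := (@measurable _ (measurableTypeR R) I).
Local Notation integ I f := (mu.-integrable I (EFin \o f)).
Local Notation int I f := (Rintegral mu I f).
Implicit Types (a b c e h s t x y M A : R) (f g phi : R -> R) (I K : set R).

(** Pointwise bounded convergence of the functions identifies, by dominated
    convergence, the limits of the derivatives against test functions. *)
Lemma weak_derivative_limit I (f_ g_ : nat -> R -> R) f M A : mset I ->
  (forall n, measurable_fun I (f_ n)) -> (forall n x, I x -> `|f_ n x| <= M) ->
  (forall x, I x -> f_ ^~ x @ \oo --> f x) ->
  (forall n, sqint mu I (g_ n)) -> (forall n, int I (fun x => g_ n x ^+ 2) <= A) ->
  (forall n, rweak I (f_ n) (g_ n)) ->
  exists g, [/\ sqint mu I g, rweak I f g &
    le_liminf (int I (fun x => g x ^+ 2)) (fun n => int I (fun x => g_ n x ^+ 2))].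
Proof.
move=> mI mf fM ff gL gA fg.
pose ell phi := - int I (fun x => f x * derive1 phi x).
have pL phi : C1_compact_support I phi -> sqint mu I phi.
  by move=> tp; have [] := test_sqint mI tp.
have cv phi : C1_compact_support I phi ->
    int I (fun x => g_ n x * phi x) @[n --> \oo] --> ell phi.
  move=> tp; have [_ [md _] id] := test_sqint mI tp.
  rewrite (_ : (fun n => _) = (fun n => - int I (fun x => f_ n x * derive1 phi x))).
    apply: cvgN; apply: (dominated_cvg_real mI _ _ (integZ mI M id)).
    + by move=> n; exact: (@measurable_funM _ (measurableTypeR R) _ _ _ _ (mf n) md).
    + by move=> x Ix; apply: cvgM; [exact: ff|exact: cvg_cst].
    + by move=> n x Ix; rewrite normrM ler_wpM2r// fM.
  by apply/funext => n; rewrite fg// opprK.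
have [g [gL' gl lg]] := weak_compactness mI (P := C1_compact_support I) pL gL gA cv.
exists g; split => // phi tp.
by rewrite (gl _ tp) /ell opprK.
Qed.

(** The norm of the weak derivative does not depend on the choice of a
    representative. *)
Lemma weak_derivative_int_eq I f g k : mset I -> mu (I `\` I°) = 0%E ->
  (forall x, I° x -> exists2 e, 0 < e & `[x - e, x + e] `<=` I) ->
  sqint mu I g -> sqint mu I k -> rweak I f g -> rweak I f k ->
  int I (fun x => g x ^+ 2) = int I (fun x => k x ^+ 2).
Proof.
move=> mI I0 Io gL kL fg fk.
have gkL := sqint_sub mI gL kL.
have gk phi : C1_compact_support I phi -> int I (fun x => (g x - k x) * phi x) = 0.
  move=> tp; have [pL _ _] := test_sqint mI tp.
  transitivity (int I (fun x => g x * phi x - k x * phi x)).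
    by apply: eq_Rintegral => x _; ring.
  rewrite (RintegralB mI (sqint_mul mI gL pL) (sqint_mul mI kL pL)).
  have := fg _ tp; have := fk _ tp; lra.
have H := weak_derivative_unique mI I0 Io gkL gk.
apply: ae_eq_int => //.
- exact: integ_mfun gL.2.
- exact: integ_mfun kL.2.
have FF := ae_filter_ringOfSetsType mu.
apply: (@filterS _ _ FF _ _ _ H) => x h Ix.
by have := h Ix; move/eqP; rewrite subr_eq0 => /eqP ->.
Qed.

Lemma hoelder_abs I f g x y : mset I -> is_interval I ->
  {within I, continuous f} -> sqint mu I f -> sqint mu I g -> rweak I f g ->
  I x -> I y -> (f x - f y) ^+ 2 <= `|x - y| * int I (fun x => g x ^+ 2).
Proof.
move=> mI iI cf fL gL fg.
wlog xy : x y / y < x.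
  move=> H Ix Iy; have [yx|yx|->] := ltgtP y x.
  - exact: H.
  - by rewrite distrC -sqrrN opprB; exact: H.
  - by rewrite !subrr normr0 mul0r expr0n.
move=> Ix Iy; rewrite gtr0_norm ?subr_gt0//.
apply: (weak_derivative_hoelder mI xy) => // z /=; rewrite in_itv/=.
exact: iI.
Qed.

(** Average (f x)^2 <= 2 (f y)^2 + 2 (f x - f y)^2 over y in an interval of length
    [h] containing [x], and bound the last term by [hoelder_abs]. *)
Lemma sup_bound I f g x a h : mset I -> is_interval I ->
  {within I, continuous f} -> sqint mu I f -> sqint mu I g -> rweak I f g ->
  0 < h -> `[a, a + h] `<=` I -> a <= x <= a + h ->
  f x ^+ 2 <= 2 * h * int I (fun x => g x ^+ 2) + 2 / h * int I (fun x => f x ^+ 2).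
Proof.
move=> mI iI cf fL gL fg h0 ahI xah.
have Ix : I x by apply: ahI; rewrite /= in_itv.
set G := int I (fun x => g x ^+ 2); have G0 : 0 <= G by exact: int_sqr_ge0.
have ah : a <= a + h by lra.
have [_ i1 e1] := ind_sqint mI ah ahI.
suff H : f x ^+ 2 * h <= 2 * int I (fun x => f x ^+ 2) + 2 * h * G * h.
  rewrite -(ler_pM2r h0); apply: (le_trans H).
  by rewrite le_eqVlt; apply/orP; left; apply/eqP; field; rewrite lt0r_neq0.
have i3 := integD mI (integZ mI 2 fL.2) (integZ mI (2 * h * G) i1).
have -> : f x ^+ 2 * h = int I (fun y => f x ^+ 2 * ind a (a + h) y).
  by rewrite RintegralZl// e1; ring.
have -> : 2 * int I (fun x => f x ^+ 2) + 2 * h * G * h =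
    int I (fun y => 2 * f y ^+ 2 + 2 * h * G * ind a (a + h) y).
  rewrite (RintegralD mI (integZ mI 2 fL.2) (integZ mI (2 * h * G) i1)).
  by rewrite (RintegralZl _ mI fL.2) (RintegralZl _ mI i1) e1; ring.
apply: le_Rintegral => //; first exact: integZ.
move=> y Iy; rewrite /ind mem_setE in_itv/=.
have [yah|_] := boolP (a <= y <= a + h); last first.
  by rewrite !mulr0 addr0 mulr_ge0// sqr_ge0.
rewrite !mulr1; have := hoelder_abs mI iI cf fL gL fg Ix Iy.
rewrite -/G => H.
have xy : `|x - y| <= h.
  by move: xah yah => /andP[? ?] /andP[? ?]; rewrite ler_norml; apply/andP; split; lra.
have := ler_wpM2r G0 xy; have := sqr_ge0 (f x - 2 * f y); nra.
Qed.

End sobolev_interval.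

(** * Complex-valued functions and edges *)

Section finite_norms.
Context {R : realType}.
Local Notation mu := (@lebesgue_measure R).
Local Notation mset I := (@measurable _ (measurableTypeR R) I).
Local Notation integ I f := (mu.-integrable I (EFin \o f)).
Implicit Types (I : set R) (f h : R -> R) (r : R).

Lemma finite_normP I h r : mset I -> 0 < r -> measurable_fun I h ->
  finite_norm mu r%:E (h \_ I) <-> integ I (fun x => `|h x| `^ r).
Proof.
move=> mI r0 mh.
have mhr : measurable_fun I (fun x => `|h x| `^ r).
  by apply: (measurableT_comp (measurable_powR r)); exact: measurableT_comp.
have E : ((\int[mu]_x `| (EFin \o (h \_ I)) x | `^ r) =
    (\int[mu]_(x in I) (`|h x| `^ r)%:E))%E.
  rewrite [RHS]integral_mkcond; apply: eq_integral => x _.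
  rewrite /= !patchE; case: ifPn => _ //=.
  by rewrite normr0 powR0// gt_eqF.
have A : (\int[mu]_(x in I) `|(`|h x| `^ r)%:E| = \int[mu]_(x in I) (`|h x| `^ r)%:E)%E.
  by apply: eq_integral => x _; rewrite gee0_abs// lee_fin powR_ge0.
rewrite /finite_norm; split => [fn|/integrableP[_]].
  apply/integrableP; split; first exact/measurable_EFinP.
  by rewrite /= A -E -poweR_Lnorm ?gt_eqF//; exact: poweR_lty.
by rewrite /= A -E => fi; rewrite unlock /=; exact: poweR_lty.
Qed.

End finite_norms.

Section complex_components.
Context {R : realType}.
Local Notation mu := (@lebesgue_measure R).
Local Notation mset I := (@measurable _ (measurableTypeR R) I).
Local Notation integ I f := (mu.-integrable I (EFin \o f)).
Local Notation int I f := (Rintegral mu I f).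
Local Notation Re := (@complex.Re R).
Local Notation Im := (@complex.Im R).
Implicit Types (I : set R) (f g u : R -> R[i]) (z : R[i]) (b : bool).

(** Indexing the real and imaginary parts by [bool] turns the components of a
    graph function into a family over the finite type of pairs of an edge and a
    boolean, to which all the real-valued results apply. *)
Definition cpt b z : R := if b then Im z else Re z.

Lemma normc_sqr z : normc z ^+ 2 = \sum_b cpt b z ^+ 2.
Proof.
rewrite big_bool; case: z => x y /=.
by rewrite sqr_sqrtr ?addr_ge0 ?sqr_ge0// addrC.
Qed.

Lemma normc_ge0 z : 0 <= normc z.
Proof. by case: z => x y; exact: sqrtr_ge0. Qed.

Lemma cpt_le_normc b z : `|cpt b z| <= normc z.
Proof.
rewrite -(@ler_pXn2r _ 2) ?nnegrE ?normc_ge0// real_normK ?num_real//.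
by rewrite normc_sqr big_bool; case: b => /=; rewrite ?lerDl ?lerDr sqr_ge0.
Qed.

Lemma measurable_normc I f : (forall b, measurable_fun I (cpt b \o f)) ->
  measurable_fun I (normc \o f).
Proof.
move=> mf.
have mE : measurable_fun I (fun x => Num.sqrt ((cpt false \o f) x ^+ 2 + (cpt true \o f) x ^+ 2)).
  apply: (measurableT_comp (continuous_measurable_fun (@sqrt_continuous R))) => //.
  by apply: measurable_funD; apply: measurable_funX.
rewrite (_ : normc \o f = fun x => Num.sqrt ((cpt false \o f) x ^+ 2 + (cpt true \o f) x ^+ 2))//.
by apply/funext => x /=; case: (f x).
Qed.

Lemma L2_onP I f : mset I -> L2_on I f <-> forall b, sqint mu I (cpt b \o f).
Proof.
move=> mI.
have E x : `|normc (f x)| `^ 2 = Re (f x) ^+ 2 + Im (f x) ^+ 2.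
  rewrite ger0_norm ?normc_ge0// powR_mulrn ?normc_ge0// normc_sqr big_bool /=.
  by rewrite addrC.
split => [[m1 m2 fn] b|H].
  have mn : measurable_fun I (normc \o f) by apply: measurable_normc => -[].
  have := (finite_normP mI (ltr0Sn _ 1) mn).1 fn; move=> i.
  have mb : measurable_fun I (cpt b \o f) by case: b.
  split => //; apply: (integ_le mI _ i); first exact: measurable_funX.
  move=> x _; rewrite /= E ger0_norm ?sqr_ge0//.
  by case: b {mb} => /=; rewrite ?lerDl ?lerDr sqr_ge0.
have [m1 i1] := H false; have [m2 i2] := H true.
have mn : measurable_fun I (normc \o f) by apply: measurable_normc => -[].
split => //; apply/(finite_normP mI (ltr0Sn _ 1) mn).
by apply: (eq_integ mI _ (integD mI i1 i2)) => x _; rewrite /= E.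
Qed.

Lemma int_normc_sqr I f : mset I -> (forall b, sqint mu I (cpt b \o f)) ->
  integ I (fun x => normc (f x) ^+ 2) /\
  int I (fun x => normc (f x) ^+ 2) = \sum_b int I (fun x => (cpt b \o f) x ^+ 2).
Proof.
move=> mI H.
have E x : normc (f x) ^+ 2 = (cpt true \o f) x ^+ 2 + (cpt false \o f) x ^+ 2.
  by rewrite normc_sqr big_bool.
split.
  by apply: (eq_integ mI _ (integD mI (H true).2 (H false).2)) => x _; rewrite E.
rewrite big_bool; apply: etrans (RintegralD mI (H true).2 (H false).2).
by apply: eq_Rintegral => x _; rewrite E.
Qed.

Lemma weak_derivativeP I u g : mset I -> weak_derivative I u g <->
  forall b, sqint mu I (cpt b \o g) /\ rweak I (cpt b \o u) (cpt b \o g).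
Proof.
move=> mI.
have E w (c : R) : (Re (w * c%:C)%C = Re w * c) * (Im (w * c%:C)%C = Im w * c).
  by case: w => x y; split => /=; rewrite mulr0 ?subr0 ?add0r.
have CE w phi : Cintegral I (fun x => w x * (phi x)%:C)%C =
    ((int I (fun x => Re (w x) * phi x)) +i* (int I (fun x => Im (w x) * phi x)))%C.
  rewrite /Cintegral; congr (_ +i* _)%C.
    by apply: eq_Rintegral => x _; rewrite E.
  by apply: eq_Rintegral => x _; rewrite E.
split => [[gL ug] b|H].
  split; first exact: (L2_onP _ mI).1.
  move=> phi tp; have := ug _ tp; rewrite !CE => -[h1 h2].
  by case: b.
split; first by apply/(L2_onP _ mI) => b; have [] := H b.
move=> phi tp; rewrite !CE.
have [_ /(_ _ tp) h1] := H false; have [_ /(_ _ tp) h2] := H true.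
by congr (_ +i* _)%C; [exact: h1|exact: h2].
Qed.

End complex_components.

Section edge_intervals.
Context {R : realType} (G : metric_graph R).
Local Notation mu := (@lebesgue_measure R).
Local Notation mset I := (@measurable _ (measurableTypeR R) I).
Implicit Types (e : edge G).

Lemma measurable_edge e : mset (interval_of e).
Proof. by case: e => e /=; exact: measurable_itv. Qed.

Lemma is_interval_edge e : is_interval (interval_of e).
Proof. by case: e => e /=; exact: interval_is_interval. Qed.

Lemma edge_ge0 e x : interval_of e x -> 0 <= x.
Proof. by case: e => e /=; rewrite in_itv/= => /andP[]. Qed.

Lemma edge_down e x y : interval_of e x -> 0 <= y <= x -> interval_of e y.
Proof.
case: e => e /=; rewrite !in_itv/= => /andP[x0 x1] /andP[y0 yx].
  by rewrite y0 (le_trans yx x1).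
by rewrite y0.
Qed.

Lemma edge_null e : mu (interval_of e `\` (interval_of e)°) = 0%E.
Proof.
apply: countable_lebesgue_measure0; apply: finite_set_countable.
case: e => e /=.
  apply: (@sub_finite_set _ _ [set 0; len e]); last exact: finite_set2.
  move=> x [] /=; rewrite interior_itv_bnd /= !in_itv/= => /andP[x0 x1] /negP.
  by rewrite negb_and -!leNgt => /orP[?|?]; [left|right]; apply/eqP; rewrite eq_le; apply/andP.
apply: (@sub_finite_set _ _ [set 0]); last exact: finite_set1.
move=> x [] /=; rewrite interior_itv_bndy /= !in_itv/= !andbT => x0 /negP; rewrite -leNgt => ?.
by apply/eqP; rewrite eq_le; apply/andP.
Qed.

Lemma edge_interior_nbhs e x : (interval_of e)° x ->
  exists2 d : R, 0 < d & `[x - d, x + d] `<=` interval_of e.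
Proof.
move=> /nbhs_ballP[d /= d0 xd]; exists (d / 2); first lra.
move=> y /=; rewrite in_itv/= => /andP[y1 y2]; apply: xd.
by rewrite /ball /= ltr_norml; apply/andP; split; lra.
Qed.

(** Every point of the graph lies in a segment of prescribed small length inside
    its edge, uniformly since there are finitely many edges. *)
Lemma edge_cover : exists2 l : R, 0 < l & forall h, 0 < h <= l ->
  forall e x, interval_of e x -> exists2 a, `[a, a + h] `<=` interval_of e & a <= x <= a + h.
Proof.
have [l [l0 Hl]] : exists l : R, 0 < l /\ forall e : internal G, l <= len e.
  have : \forall l \near (0:R)^'+, 0 < l /\ forall e : internal G, l <= len e.
    near=> l; split => //; near: l; apply: filter_forall => e.
    by apply: nbhs_right_le; exact: len_gt0.
  by move=> /filter_ex.
exists l => // h /andP[h0 hl] e x.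
case: e => e /=; rewrite in_itv/= => /andP[x0 x1].
  have := Hl e => le.
  have [xh|xh] := leP (x + h) (len e).
    exists x; last by apply/andP; split; lra.
    by move=> y /=; rewrite !in_itv/= => /andP[? ?]; apply/andP; split; lra.
  exists (len e - h); last by apply/andP; split; lra.
  by move=> y /=; rewrite !in_itv/= => /andP[? ?]; apply/andP; split; lra.
exists x; last by apply/andP; split; lra.
by move=> y /=; rewrite !in_itv/= => /andP[? ?]; rewrite andbT; lra.
Unshelve. all: end_near. Qed.

End edge_intervals.

(** * The space H^1 of a metric graph *)

Section graph_H1.
Context {R : realType} {G : metric_graph R}.
Local Notation mu := (@lebesgue_measure R).
Local Notation integ I f := (mu.-integrable I (EFin \o f)).
Local Notation int I f := (Rintegral mu I f).
Local Notation ivl e := (interval_of e).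
Implicit Types (u : graph_fun G) (e : edge G) (b : bool).

Definition dirichlet u : R := graph_integral (fun e x => normc (gderiv u e x) ^+ 2).

Lemma H1_components u : H1 u -> forall e b,
  [/\ {within ivl e, continuous (cpt b \o u e)}, sqint mu (ivl e) (cpt b \o u e),
    sqint mu (ivl e) (cpt b \o gderiv u e) &
    rweak (ivl e) (cpt b \o u e) (cpt b \o gderiv u e)].
Proof.
move=> [[cu _] Hu] e b; have mI := measurable_edge e.
have [uL ex] := Hu e; have wu := xgetPex (fun=> 0) ex.
have [gL ug] := (weak_derivativeP _ _ mI).1 wu b.
split => //; first by have [? ?] := cu e; case: b {gL ug}.
exact: (L2_onP _ mI).1.
Qed.

Lemma H1_of_components u (g : edge G -> bool -> R -> R) : graph_continuous u ->
  (forall e b, sqint mu (ivl e) (cpt b \o u e)) ->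
  (forall e b, sqint mu (ivl e) (g e b)) ->
  (forall e b, rweak (ivl e) (cpt b \o u e) (g e b)) -> H1 u.
Proof.
move=> cu uL gL ug; split => // e; have mI := measurable_edge e.
split; first exact/(L2_onP _ mI).
exists (fun x => (g e false x +i* g e true x)%C); apply/(weak_derivativeP _ _ mI) => b.
by case: b; [split; [exact: (gL e true)|exact: (ug e true)]|
  split; [exact: (gL e false)|exact: (ug e false)]].
Qed.

Lemma L2normsqE u : H1 u ->
  L2normsq u = \sum_(j : edge G * bool) int (ivl j.1) (fun x => (cpt j.2 \o u j.1) x ^+ 2).
Proof.
move=> Hu; rewrite /L2normsq /graph_integral.
rewrite -(pair_bigA _ (fun e b => int (ivl e) (fun x => (cpt b \o u e) x ^+ 2))) /=.
apply: eq_bigr => e _.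
have H b : sqint mu (ivl e) (cpt b \o u e) by have [] := H1_components Hu e b.
by have [_ ->] := int_normc_sqr (measurable_edge e) H.
Qed.

Lemma dirichletE u : H1 u -> dirichlet u =
  \sum_(j : edge G * bool) int (ivl j.1) (fun x => (cpt j.2 \o gderiv u j.1) x ^+ 2).
Proof.
move=> Hu; rewrite /dirichlet /graph_integral.
rewrite -(pair_bigA _ (fun e b => int (ivl e) (fun x => (cpt b \o gderiv u e) x ^+ 2))) /=.
apply: eq_bigr => e _.
have H b : sqint mu (ivl e) (cpt b \o gderiv u e) by have [] := H1_components Hu e b.
by have [_ ->] := int_normc_sqr (measurable_edge e) H.
Qed.

Lemma dirichlet_eq u (g : edge G -> bool -> R -> R) : H1 u ->
  (forall e b, sqint mu (ivl e) (g e b)) ->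
  (forall e b, rweak (ivl e) (cpt b \o u e) (g e b)) ->
  dirichlet u = \sum_(j : edge G * bool) int (ivl j.1) (fun x => g j.1 j.2 x ^+ 2).
Proof.
move=> Hu gL ug; rewrite dirichletE//; apply: eq_bigr => -[e b] _ /=.
have [_ _ kL uk] := H1_components Hu e b.
apply: (weak_derivative_int_eq (measurable_edge e) (edge_null e) _ kL (gL e b) uk (ug e b)).
exact: edge_interior_nbhs.
Qed.

Lemma dirichlet_ge0 u : 0 <= dirichlet u.
Proof. by apply: sumr_ge0 => e _; apply: Rintegral_ge0 => x _; exact: sqr_ge0. Qed.

Lemma L2normsq_ge0 u : 0 <= L2normsq u.
Proof. by apply: sumr_ge0 => e _; apply: Rintegral_ge0 => x _; exact: sqr_ge0. Qed.

Lemma component_le_sum (F : edge G * bool -> R) j : (forall i, 0 <= F i) -> F j <= \sum_i F i.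
Proof. by move=> F0; rewrite (bigD1 j)//= lerDl sumr_ge0. Qed.

Lemma edge_le_sum (F : edge G * bool -> R) e : (forall i, 0 <= F i) ->
  \sum_b F (e, b) <= \sum_i F i.
Proof.
move=> F0; have -> : \sum_i F i = \sum_e \sum_b F (e, b).
  by rewrite pair_bigA; apply: eq_bigr => -[].
by rewrite (bigD1 e)//= lerDl sumr_ge0// => i _; exact: sumr_ge0.
Qed.

(** The parameter [h] can be taken small: the supremum then costs only a small
    multiple of the Dirichlet integral.  This gives the coercivity of the form,
    and makes functions of small mass in a ball uniformly small. *)
Lemma H1_sup : exists2 l : R, 0 < l & forall h, 0 < h <= l -> forall u, H1 u ->
  forall e x, ivl e x ->
  normc (u e x) ^+ 2 <= 2 * h * dirichlet u + 2 / h * L2normsq u.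
Proof.
have [l l0 cover] := edge_cover G; exists l => // h /[dup] hl /andP[h0 _] u Hu e x Ix.
have [a aI xa] := cover h hl e x Ix.
rewrite normc_sqr dirichletE// L2normsqE//.
pose F j := 2 * h * int (ivl j.1) (fun x => (cpt j.2 \o gderiv u j.1) x ^+ 2)
  + 2 / h * int (ivl j.1) (fun x => (cpt j.2 \o u j.1) x ^+ 2).
apply: (@le_trans _ _ (\sum_b F (e, b))).
  apply: ler_sum => b _; have [cu uL gL ug] := H1_components Hu e b.
  exact: (sup_bound (measurable_edge e) (@is_interval_edge _ _ e) cu uL gL ug h0 aI xa).
apply: le_trans (edge_le_sum e _) _; last by rewrite big_split /= -!mulr_sumr.
move=> i; rewrite addr_ge0// mulr_ge0 ?int_sqr_ge0//; first by rewrite mulr_ge0// ltW.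
by rewrite divr_ge0// ltW.
Qed.

Lemma attached_edge e x v : attached e x v -> ivl e x.
Proof.
case: e => e /=; rewrite in_itv/=.
  by move=> [[-> _]|[-> _]]; rewrite ?lexx ?(ltW (len_gt0 _)).
by move=> [-> _]; rewrite lexx.
Qed.

Lemma at_vertexE u e x v : graph_continuous u -> attached e x v -> at_vertex u v = u e x.
Proof.
move=> [_ cu] av; rewrite /at_vertex.
have ex : exists z, [set z | exists e x, attached e x v /\ z = u e x] z.
  by exists (u e x), e, x.
by have [e' [x' [av' ->]]] := xgetPex 0 ex; exact: cu av' av.
Qed.

Lemma at_vertexN u v : (forall e x, ~ attached e x v) -> at_vertex u v = 0.
Proof. by move=> nav; apply: xgetPN => z [e [x [av _]]]; exact: nav av. Qed.

Lemma at_vertex_cases u v : graph_continuous u ->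
  at_vertex u v = 0 \/ exists e x, ivl e x /\ at_vertex u v = u e x.
Proof.
move=> cu; have [[e [x av]]|nav] := pselect (exists e x, attached e x v).
  right; exists e, x; split; [exact: attached_edge av|exact: at_vertexE].
by left; apply: at_vertexN => e x av; apply: nav; exists e, x.
Qed.

Definition gscale (t : R) u : graph_fun G := fun e x => ((t%:C)%C * u e x).

Lemma cpt_scale t (z : R[i]) b : cpt b ((t%:C)%C * z) = t * cpt b z.
Proof. by case: z => x y; case: b; rewrite /= mul0r ?addr0 ?subr0. Qed.

Lemma normc_scale t (z : R[i]) : 0 <= t -> normc ((t%:C)%C * z) = t * normc z.
Proof.
move=> t0; apply/eqP; rewrite -(@eqrXn2 _ 2) ?mulr_ge0 ?normc_ge0//.
apply/eqP; rewrite exprMn !normc_sqr mulr_sumr; apply: eq_bigr => b _.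
by rewrite cpt_scale exprMn.
Qed.

Lemma rweak_scale t (I : set R) f g : measurable (I : set (measurableTypeR R)) ->
  sqint mu I f -> sqint mu I g -> rweak I f g ->
  rweak I (fun x => t * f x) (fun x => t * g x).
Proof.
move=> mI fL gL fg phi tp; have [pL p'L _] := test_sqint mI tp.
have -> : int I (fun x => t * f x * derive1 phi x) = t * int I (fun x => f x * derive1 phi x).
  rewrite -(RintegralZl _ mI (sqint_mul mI fL p'L)).
  by apply: eq_Rintegral => x _; rewrite mulrA.
have -> : int I (fun x => t * g x * phi x) = t * int I (fun x => g x * phi x).
  rewrite -(RintegralZl _ mI (sqint_mul mI gL pL)).
  by apply: eq_Rintegral => x _; rewrite mulrA.
by rewrite fg// mulrN.
Qed.

Lemma sqint_scale t (I : set R) f : measurable (I : set (measurableTypeR R)) ->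
  sqint mu I f -> sqint mu I (fun x => t * f x).
Proof.
move=> mI fL; have := sqint_comb mI t 0 fL fL.
rewrite (_ : (fun x => _) = fun x => t * f x)//.
by apply/funext => x; rewrite mul0r addr0.
Qed.

Lemma within_continuous_scale t (I : set R) (f : R -> R) :
  {within I, continuous f} -> {within I, continuous (fun x => t * f x)}.
Proof. by move=> cf x; apply: cvgM; [exact: cvg_cst|exact: cf]. Qed.

Lemma cpt_gscale t u e b : cpt b \o gscale t u e = fun x => t * (cpt b \o u e) x.
Proof. by apply/funext => x; exact: cpt_scale. Qed.

Lemma H1_gscale t u : H1 u -> H1 (gscale t u) /\
  dirichlet (gscale t u) = t ^+ 2 * dirichlet u.
Proof.
move=> Hu; have C := H1_components Hu.
pose g e b x := t * (cpt b \o gderiv u e) x.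
have gL e b : sqint mu (ivl e) (g e b).
  by have [_ _ gL _] := C e b; apply: sqint_scale => //; exact: measurable_edge.
have ug e b : rweak (ivl e) (cpt b \o gscale t u e) (g e b).
  have [cu uL kL uk] := C e b; rewrite cpt_gscale.
  by apply: rweak_scale => //; exact: measurable_edge.
have Ht : H1 (gscale t u).
  apply: (@H1_of_components _ g) => //.
    split => [e|e x e' x' v av av'].
      split.
        rewrite (_ : _ \o _ = cpt false \o gscale t u e)// cpt_gscale.
        by apply: within_continuous_scale; have [] := C e false.
      rewrite (_ : _ \o _ = cpt true \o gscale t u e)// cpt_gscale.
      by apply: within_continuous_scale; have [] := C e true.
    by rewrite /gscale; congr (_ * _); exact: Hu.1.2 av av'.
  move=> e b; rewrite cpt_gscale; apply: sqint_scale; first exact: measurable_edge.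
  by have [] := C e b.
split => //; rewrite (dirichlet_eq Ht gL ug) dirichletE// mulr_sumr.
apply: eq_bigr => -[e b] _ /=; have [_ _ kL _] := C e b.
rewrite -(RintegralZl _ (measurable_edge e) kL.2).
by apply: eq_Rintegral => x _; rewrite /g exprMn.
Qed.

Lemma L2normsq_gscale t u : H1 u -> L2normsq (gscale t u) = t ^+ 2 * L2normsq u.
Proof.
move=> Hu; have [Ht _] := H1_gscale t Hu; rewrite !L2normsqE// mulr_sumr.
apply: eq_bigr => -[e b] _ /=; have [_ kL _ _] := H1_components Hu e b.
rewrite -(RintegralZl _ (measurable_edge e) kL.2).
by apply: eq_Rintegral => x _; rewrite /= cpt_scale exprMn.
Qed.

Lemma at_vertex_gscale t u v : graph_continuous u ->
  at_vertex (gscale t u) v = ((t%:C)%C * at_vertex u v).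
Proof.
move=> cu; have [[e [x av]]|nav] := pselect (exists e x, attached e x v).
  rewrite (at_vertexE cu av).
  have ex : exists z, [set z | exists e x, attached e x v /\ z = gscale t u e x] z.
    by exists (gscale t u e x), e, x.
  have [e' [x' [av' E]]] := xgetPex 0 ex.
  by rewrite /at_vertex E /gscale (cu.2 _ _ _ _ _ av' av).
have nav' e x : ~ attached e x v by move=> av; apply: nav; exists e, x.
by rewrite !at_vertexN// mulr0.
Qed.

End graph_H1.

(** * Compactness in H^1 *)

Section graph_compactness.
Context {R : realType} {G : metric_graph R}.
Local Notation mu := (@lebesgue_measure R).
Local Notation integ I f := (mu.-integrable I (EFin \o f)).
Local Notation int I f := (Rintegral mu I f).
Local Notation ivl e := (interval_of e).
Implicit Types (u : graph_fun G) (e : edge G) (b : bool).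

Lemma hoelder_within_continuous (I : set R) (f : R -> R) (K : R) : 0 <= K ->
  (forall x y, I x -> I y -> (f x - f y) ^+ 2 <= `|x - y| * K) ->
  {within I, continuous f}.
Proof.
move=> K0 fK; apply/subspace_continuousP => x Ix.
apply/cvgrPdist_le => e e0; rewrite near_withinE; near=> y => Iy.
rewrite -(@ler_pXn2r _ 2) ?nnegrE//; last exact: ltW.
rewrite real_normK ?num_real//; apply: (le_trans (fK _ _ Ix Iy)).
have K1 : 0 < K + 1 by lra.
apply: (@le_trans _ _ (`|x - y| * (K + 1))); first by rewrite ler_wpM2l//; lra.
rewrite -ler_pdivlMr//; near: y.
apply: (@cvgr_dist_le _ _ _ (nbhs x) _ id x) => //.
by apply: divr_gt0; [exact: exprn_gt0|lra].
Unshelve. all: end_near. Qed.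

(** Bounded sequences of H^1 have pointwise convergent subsequences with limit in
    H^1: [H1_sup] and the Hoelder estimate give a uniformly bounded equicontinuous
    family of components, and weak limits of the derivatives differentiate the
    pointwise limit.  Mass may be lost, but the Dirichlet integral is lower
    semicontinuous. *)
Lemma H1_compactness (u_ : nat -> graph_fun G) (K c : R) :
  (forall n, H1 (u_ n)) -> (forall n, dirichlet (u_ n) <= K) ->
  (forall n, L2normsq (u_ n) <= c) ->
  exists (s : nat -> nat) (u : graph_fun G),
  [/\ forall k, (k <= s k)%N, H1 u,
    forall e x, ivl e x -> forall b, cpt b (u_ (s k) e x) @[k --> \oo] --> cpt b (u e x) &
    le_liminf (dirichlet u) (fun k => dirichlet (u_ (s k)))].
Proof.
move=> uH uK uc.
have K0 : 0 <= K := le_trans (dirichlet_ge0 _) (uK 0%N).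
have c0 : 0 <= c := le_trans (L2normsq_ge0 _) (uc 0%N).
have [l l0 sup] := @H1_sup R G.
have ll : 0 < l <= l by rewrite l0 lexx.
pose M := Num.sqrt (2 * l * K + 2 / l * c).
have uM n (j : edge G * bool) x : ivl j.1 x -> `|(cpt j.2 \o u_ n j.1) x| <= M.
  move=> Ix; apply: le_trans (cpt_le_normc _ _) _.
  have N0 : 0 <= 2 * l * K + 2 / l * c.
    by rewrite addr_ge0// mulr_ge0// ?divr_ge0 ?mulr_ge0 ?ltW.
  rewrite -(@ler_pXn2r _ 2) ?nnegrE ?normc_ge0 ?sqrtr_ge0// sqr_sqrtr//.
  apply: le_trans (sup l ll _ (uH n) _ _ Ix) _; apply: lerD.
    by rewrite ler_wpM2l// mulr_ge0// ltW.
  by rewrite ler_wpM2l// divr_ge0// ltW.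
have gK n j : int (ivl j.1) (fun x => (cpt j.2 \o gderiv (u_ n) j.1) x ^+ 2) <= K.
  apply: le_trans (uK n); rewrite dirichletE//.
  exact: (component_le_sum (F := fun j => int (ivl j.1) (fun x => (cpt j.2 \o gderiv (u_ n) j.1) x ^+ 2)) j
    (fun i => int_sqr_ge0 _ _ _)).
have uhK n (j : edge G * bool) x y : ivl j.1 x -> ivl j.1 y ->
    ((cpt j.2 \o u_ n j.1) x - (cpt j.2 \o u_ n j.1) y) ^+ 2 <= `|x - y| * K.
  move=> Ix Iy; have [cu uL gL ug] := H1_components (uH n) j.1 j.2.
  apply: le_trans (hoelder_abs (measurable_edge j.1) (@is_interval_edge _ _ j.1) cu uL gL ug Ix Iy) _.
  by rewrite ler_wpM2l.
have [s [g [sk sg gM ghK]]] := @pointwise_extraction R _ (fun j : edge G * bool => ivl j.1)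
  (fun n j => cpt j.2 \o u_ n j.1) M K K0 (fun j x => @edge_ge0 _ _ j.1 x)
  (fun j x y => @edge_down _ _ j.1 x y) uM uhK.
pose u : graph_fun G := fun e x => (g (e, false) x +i* g (e, true) x)%C.
have ug e b : cpt b \o u e = g (e, b) by apply/funext => x; case: b.
have us e x : ivl e x -> forall b, cpt b (u_ (s k) e x) @[k --> \oo] --> cpt b (u e x).
  by move=> Ix b; rewrite -/((cpt b \o u e) x) ug; exact: (sg (e, b) x Ix).
have cg e b : {within ivl e, continuous (g (e, b))}.
  by apply: (hoelder_within_continuous K0) => x y; exact: (ghK (e, b)).
have cu : graph_continuous u.
  split=> [e|e x e' x' v av av'].
    by split; [rewrite (_ : _ \o _ = cpt false \o u e)//|rewrite (_ : _ \o _ = cpt true \o u e)//];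
      rewrite ug.
  suff H b : cpt b (u e x) = cpt b (u e' x') by rewrite /u; congr (_ +i* _)%C; [exact: (H false)|exact: (H true)].
  have h1 := us _ _ (attached_edge av) b; have h2 := us _ _ (attached_edge av') b.
  have E : (fun k => cpt b (u_ (s k) e x)) = (fun k => cpt b (u_ (s k) e' x')).
    by apply/funext => k; rewrite ((uH (s k)).1.2 _ _ _ _ _ av av').
  rewrite E in h1; have <- := cvg_lim (@norm_hausdorff _ R) h1.
  exact: (cvg_lim (@norm_hausdorff _ R) h2).
have uL e b : sqint mu (ivl e) (cpt b \o u e).
  have mI := measurable_edge e.
  have ukL k : sqint mu (ivl e) (cpt b \o u_ (s k) e) by have [] := H1_components (uH (s k)) e b.
  have mu' : measurable_fun (ivl e) (cpt b \o u e).
    by apply: (measurable_fun_cvg (fun k => (ukL k).1)) => x Ix; exact: us.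
  split => //.
  have [//] : integ (ivl e) (fun x => (cpt b \o u e) x ^+ 2) /\
      le_liminf (int (ivl e) (fun x => (cpt b \o u e) x ^+ 2))
        (fun k => int (ivl e) (fun x => (cpt b \o u_ (s k) e) x ^+ 2)).
    apply: (@fatou_real _ _ _ mu (ivl e) mI (fun k x => (cpt b \o u_ (s k) e) x ^+ 2) _ c).
    - by move=> k; exact: (ukL k).2.
    - by move=> k x _; exact: sqr_ge0.
    - exact: measurable_funX.
    - by move=> x _; exact: sqr_ge0.
    - apply: aeW => x Ix; have h := us _ _ Ix b.
      exact: (cvgM h h).
    - move=> k; apply: le_trans (uc (s k)); rewrite L2normsqE//.
      exact: (component_le_sum (F := fun j => int (ivl j.1) (fun x => (cpt j.2 \o u_ (s k) j.1) x ^+ 2)) (e, b)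
        (fun i => int_sqr_ge0 _ _ _)).
have W (j : edge G * bool) : exists k, [/\ sqint mu (ivl j.1) k, rweak (ivl j.1) (cpt j.2 \o u j.1) k &
    le_liminf (int (ivl j.1) (fun x => k x ^+ 2))
      (fun k => int (ivl j.1) (fun x => (cpt j.2 \o gderiv (u_ (s k)) j.1) x ^+ 2))].
  have C k := H1_components (uH (s k)) j.1 j.2.
  apply: (@weak_derivative_limit R (ivl j.1) (fun k => cpt j.2 \o u_ (s k) j.1) _ _ M K (measurable_edge j.1)).
  - by move=> k; have [_ [] ] := C k.
  - by move=> k x; exact: uM.
  - by move=> x Ix; exact: us.
  - by move=> k; have [] := C k.
  - by move=> k; exact: gK.
  - by move=> k; have [] := C k.
pose h j := projT1 (cid (W j)).
have hP j : [/\ sqint mu (ivl j.1) (h j), rweak (ivl j.1) (cpt j.2 \o u j.1) (h j) &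
    le_liminf (int (ivl j.1) (fun x => h j x ^+ 2))
      (fun k => int (ivl j.1) (fun x => (cpt j.2 \o gderiv (u_ (s k)) j.1) x ^+ 2))].
  by rewrite /h; case: cid.
pose h' e b := h (e, b).
have hL e b : sqint mu (ivl e) (h' e b) by have [] := hP (e, b).
have uh e b : rweak (ivl e) (cpt b \o u e) (h' e b) by have [] := hP (e, b).
have Hu : H1 u by exact: H1_of_components hL uh.
exists s, u; split => //.
rewrite (dirichlet_eq Hu hL uh).
rewrite (_ : (fun k => _) = (fun k => \sum_(j : edge G * bool)
    int (ivl j.1) (fun x => (cpt j.2 \o gderiv (u_ (s k)) j.1) x ^+ 2))); last first.
  by apply/funext => k; rewrite dirichletE.
apply: (le_liminf_sum (x := fun j : edge G * bool => int (ivl j.1) (fun x => h' j.1 j.2 x ^+ 2))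
  (u := fun j k => int (ivl j.1) (fun x => (cpt j.2 \o gderiv (u_ (s k)) j.1) x ^+ 2))).
by case=> e b; have [] := hP (e, b).
Qed.

End graph_compactness.

(** * The potential and the coercivity of the form *)

Section potential.
Context {R : realType} {G : metric_graph R}.
Local Notation mu := (@lebesgue_measure R).
Local Notation mset I := (@measurable _ (measurableTypeR R) I).
Local Notation integ I f := (mu.-integrable I (EFin \o f)).
Local Notation int I f := (Rintegral mu I f).
Local Notation ivl e := (interval_of e).
Implicit Types (u : graph_fun G) (e : edge G) (b : bool) (W : potential G) (w d q : R).

Lemma cvg_powR (u : R^nat) (l a : R) : 0 < a -> (forall n, 0 <= u n) -> u @ \oo --> l ->
  (u n) `^ a @[n --> \oo] --> l `^ a.
Proof.
move=> a0 u0 ul.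
have l0 : 0 <= l.
  rewrite -(cvg_lim (@norm_hausdorff _ R) ul); apply: limr_ge; first by apply/cvg_ex; exists l.
  exact: nearW.
have [l1|l1] := eqVneq l 0.
  rewrite l1 powR0 ?gt_eqF//; rewrite l1 in ul.
  apply/cvgrPdist_le => e e0.
  have e1 : 0 < e `^ a^-1 by exact: powR_gt0.
  move/cvgrPdist_le: ul => /(_ _ e1); apply: filterS => n.
  rewrite !sub0r !normrN ger0_norm// ger0_norm ?powR_ge0// => un.
  rewrite -[leRHS](_ : (e `^ a^-1) `^ a = _); last first.
    by rewrite -powRrM mulVf ?gt_eqF// powRr1// ltW.
  by apply: (ge0_ler_powR (ltW a0)) => //; rewrite nnegrE ?u0 ?powR_ge0.
have lp : 0 < l by rewrite lt_neqAle eq_sym l1.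
rewrite {2}/powR gt_eqF//.
have c0 : ln (u n) @[n --> \oo] --> ln l.
  by apply: continuous_cvg => //; exact: continuous_ln.
have c1 : expR (a * ln (u n)) @[n --> \oo] --> expR (a * ln l).
  apply: continuous_cvg; first exact: continuous_expR.
  by apply: cvgM => //; exact: cvg_cst.
apply: cvg_trans c1; apply: near_eq_cvg; near=> n.
rewrite /powR gt_eqF//; near: n; exact: (cvgr_gt _ ul).
Unshelve. all: end_near. Qed.

(** Where [w] exceeds [d] it is dominated by its power: every nonnegative L^q
    function with q >= 1 is at most an arbitrarily small constant plus an L^1
    function. *)
Lemma le_powR_split w d q : 0 <= w -> 0 < d -> 1 <= q -> w <= d + d * (w / d) `^ q.
Proof.
move=> w0 d0 q1; have [wd|wd] := leP w d.
  by apply: (le_trans wd); rewrite lerDl mulr_ge0 ?powR_ge0// ltW.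
apply: (@le_trans _ _ (d * (w / d) `^ q)); last by rewrite lerDr ltW.
have : w / d <= (w / d) `^ q by apply: le1r_powR => //; rewrite ler_pdivlMr// mul1r ltW.
by rewrite -(ler_pM2l d0) mulrC divfK ?gt_eqF.
Qed.

Lemma integ_Linfty (I : set R) (B g : R -> R) : mset I -> Lq_on I +oo%E B -> integ I g ->
  (forall x, I x -> 0 <= g x) -> integ I (fun x => B x * g x).
Proof.
move=> mI [mB]; rewrite /finite_norm unlock.
have -> : (0 < mu [set: R])%E.
  have m01 : mu `[0:R, 1]%classic = 1%E by rewrite lebesgue_measure_itv/= lte_fin ltr01 oppr0 adde0.
  apply: (@lt_le_trans _ _ (mu `[0:R, 1]%classic)); first by rewrite m01 lte_fin.
  by apply: le_measure => //; rewrite inE//; exact: measurable_itv.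
move=> Bf ig g0.
have [C C0 Cub] : exists2 C : R, 0 <= C & {ae mu, forall x, I x -> `|B x| <= C}.
  pose C := Num.max 0 (fine (ess_sup mu (abse \o (EFin \o (B \_ I))))).
  exists C; first by rewrite /C le_max lexx.
  have := ess_sup_ge mu (abse \o (EFin \o (B \_ I))).
  have FF := ae_filter_ringOfSetsType mu.
  apply: (@filterS _ _ FF) => x /= + Ix; rewrite patchE mem_set// => Bx.
  rewrite /C le_max; apply/orP; right.
  rewrite -lee_fin fineK//; rewrite fin_numE; apply/andP; split.
    by apply/eqP => h; rewrite h in Bx.
  by apply/eqP => h; rewrite h ltxx in Bf.
have mg := integ_mfun ig.
have mBg : measurable_fun I (fun x => B x * g x) by exact: measurable_funM.
apply/integrableP; split; first exact/measurable_EFinP.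
have := integZ mI C ig => iCg.
apply: (@le_lt_trans _ _ (\int[mu]_(x in I) (C * g x)%:E)%E); last first.
  by rewrite -(intE mI iCg) ltry.
apply: ae_ge0_le_integral => //.
- by apply: measurableT_comp => //; exact/measurable_EFinP.
- by move=> x Ix; rewrite lee_fin mulr_ge0// g0.
- by apply/measurable_EFinP; exact: integ_mfun iCg.
have FF := ae_filter_ringOfSetsType mu.
apply: (@filterS _ _ FF _ _ _ Cub) => x Bx Ix /=.
by rewrite lee_fin normrM [`|g x|]ger0_norm ?g0// ler_wpM2r ?g0// Bx.
Qed.

(** The two consequences of the integrability assumptions that the minimization
    uses: the potential is a bounded perturbation of an L^1 function as far as
    products with bounded integrable functions are concerned, and its negative
    part is an L^1 function up to an arbitrarily small constant.  The second one
    is what places the essential spectrum in the nonnegative half-line. *)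
Definition admissible W := forall e,
  (forall g M, integ (ivl e) g -> (forall x, ivl e x -> 0 <= g x <= M) ->
    integ (ivl e) (fun x => W e x * g x)) /\
  (forall d, 0 < d -> exists2 A : R -> R, integ (ivl e) A &
    forall x, ivl e x -> 0 <= A x /\ - (d + A x) <= W e x).

Lemma assumption2_admissible p W : assumption2 p W -> admissible W.
Proof.
move=> [Wp [Wm [WE [A [B [A1 Boo ABE]]] [q /andP[q1 _] Wq]]]] e.
have mI := measurable_edge e; have q0 : 0 < q by lra.
have [mA fA] := A1 e; have [mM fM] := Wq e.
have iA := (finite_normP mI ltr01 mA).1 fA.
have iM := (finite_normP mI q0 mM).1 fM.
have E x : ivl e x -> W e x = A e x + B e x - Wm e x.
  by move=> Ix; have [_ _ ->] := WE e x Ix; rewrite (ABE e x Ix).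
have Wm0 x : ivl e x -> 0 <= Wm e x by move=> Ix; have [_ ? _] := WE e x Ix.
split=> [g M ig gM|d d0].
  have mg := integ_mfun ig.
  have g0 x : ivl e x -> 0 <= g x by move=> /gM/andP[].
  have i1 : integ (ivl e) (fun x => A e x * g x).
    apply: (integ_le mI _ (integZ mI M iA)).
      by apply: (@measurable_funM _ (measurableTypeR R)).
    move=> x Ix; have /andP[h0 hM] := gM x Ix.
    rewrite normrM powRr1// [`|g x|]ger0_norm// mulrC ler_wpM2r//.
  have i2 := integ_Linfty mI (Boo e) ig g0.
  have i3 : integ (ivl e) (fun x => Wm e x * g x).
    apply: (integ_le mI _ (integD mI ig (integZ mI M iM))).
      by apply: (@measurable_funM _ (measurableTypeR R)).
    move=> x Ix; have /andP[h0 hM] := gM x Ix.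
    have w0 := Wm0 x Ix; rewrite !ger0_norm ?mulr_ge0//.
    have := le_powR_split w0 ltr01 q1; rewrite divr1 mul1r => h.
    have P0 := powR_ge0 (Wm e x) q.
    apply: (le_trans (ler_wpM2r h0 h)); rewrite mulrDl mul1r lerD2l mulrC.
    by rewrite ler_wpM2r.
  apply: (eq_integ mI _ (integB mI (integD mI i1 i2) i3)) => x; rewrite inE => Ix.
  by rewrite E//; ring.
(* this is d (Wm / d)^q, as in [le_powR_split] *)
pose D x := d * d^-1 `^ q * (`|Wm e x| `^ q).
exists D; first exact: integZ.
move=> x Ix; have w0 := Wm0 x Ix.
have DE : D x = d * (Wm e x / d) `^ q.
  have d1 : 0 <= d^-1 by rewrite invr_ge0 ltW.
  by rewrite /D ger0_norm// powRM//; ring.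
split; first by rewrite DE mulr_ge0 ?powR_ge0// ltW.
have [p0 _ ->] := WE e x Ix; have := le_powR_split w0 d0 q1; rewrite -DE; lra.
Qed.

Definition potential_energy W u : R :=
  graph_integral (fun e x => W e x * normc (u e x) ^+ 2).

Lemma measurable_normc_H1 u e : H1 u -> measurable_fun (ivl e) (normc \o u e).
Proof. by move=> Hu; apply: measurable_normc => b; have [_ []] := H1_components Hu e b. Qed.

Lemma integ_normc_sqr u e : H1 u -> integ (ivl e) (fun x => normc (u e x) ^+ 2).
Proof.
move=> Hu; have H b : sqint mu (ivl e) (cpt b \o u e) by have [] := H1_components Hu e b.
by have [] := int_normc_sqr (measurable_edge e) H.
Qed.

Lemma H1_bounded u : H1 u -> exists2 S : R, 0 <= S & forall e x, ivl e x -> normc (u e x) ^+ 2 <= S.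
Proof.
move=> Hu; have [l l0 sup] := @H1_sup R G.
exists (2 * l * dirichlet u + 2 / l * L2normsq u).
  by rewrite addr_ge0// mulr_ge0 ?dirichlet_ge0 ?L2normsq_ge0 ?divr_ge0 ?mulr_ge0 ?ltW.
by move=> e x Ix; apply: sup => //; rewrite l0 lexx.
Qed.

Lemma integ_potential W u e : admissible W -> H1 u ->
  integ (ivl e) (fun x => W e x * normc (u e x) ^+ 2).
Proof.
move=> aW Hu; have [S _ uS] := H1_bounded Hu; have [h _] := aW e.
apply: (h _ S); first exact: integ_normc_sqr.
by move=> x Ix; rewrite sqr_ge0 uS.
Qed.

Lemma qformE W alpha u : qform W alpha u = dirichlet u + potential_energy W u
  - \sum_(v : vertex G) alpha v * normc (at_vertex u v) ^+ 2.
Proof. by []. Qed.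

Lemma qform_gscale W alpha t u : admissible W -> 0 <= t -> H1 u ->
  qform W alpha (gscale t u) = t ^+ 2 * qform W alpha u.
Proof.
move=> aW t0 Hu; rewrite !qformE.
have [_ ->] := H1_gscale t Hu.
have -> : potential_energy W (gscale t u) = t ^+ 2 * potential_energy W u.
  rewrite /potential_energy /graph_integral mulr_sumr; apply: eq_bigr => e _.
  rewrite -(RintegralZl _ (measurable_edge e) (integ_potential e aW Hu)).
  by apply: eq_Rintegral => x _; rewrite /gscale normc_scale// exprMn; ring.
have -> : \sum_v alpha v * normc (at_vertex (gscale t u) v) ^+ 2 =
    t ^+ 2 * \sum_v alpha v * normc (at_vertex u v) ^+ 2.
  rewrite mulr_sumr; apply: eq_bigr => v _.
  rewrite (at_vertex_gscale t v Hu.1) normc_scale// exprMn; ring.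
ring.
Qed.

Lemma at_vertex_le u v (S : R) : graph_continuous u -> 0 <= S ->
  (forall e x, ivl e x -> normc (u e x) ^+ 2 <= S) -> normc (at_vertex u v) ^+ 2 <= S.
Proof.
move=> cu S0 uS; have [->|[e [x [Ix ->]]]] := at_vertex_cases v cu; last exact: uS.
by rewrite normc_sqr big_bool /= expr0n /= addr0.
Qed.

(** The negative part of the potential and the vertex terms are at most a constant
    times the mass plus a constant times the squared supremum.  [H1_sup] with a
    small parameter absorbs the latter into half the Dirichlet integral. *)
Lemma qform_coercive W alpha : admissible W -> exists2 C : R, 0 <= C &
  forall u, H1 u -> 2^-1 * dirichlet u - C * L2normsq u <= qform W alpha u.
Proof.
move=> aW; have [l l0 sup] := @H1_sup R G.
have ex e := (aW e).2 1 ltr01.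
pose A e := projT1 (cid2 (ex e)).
have Ai e : integ (ivl e) (A e) by rewrite /A; case: cid2.
have AW e x : ivl e x -> 0 <= A e x /\ - (1 + A e x) <= W e x.
  by rewrite /A; case: cid2 => ? ? h; exact: h.
pose T := \sum_e int (ivl e) (A e) + \sum_v `|alpha v|.
have a0 : 0 <= \sum_e int (ivl e) (A e).
  by apply: sumr_ge0 => e _; apply: Rintegral_ge0 => x /AW[].
have v0 : 0 <= \sum_v `|alpha v| by apply: sumr_ge0.
have T0 : 0 <= T by exact: addr_ge0.
(* chosen so that the supremum, multiplied by [T], costs half the Dirichlet
   integral *)
pose h := Num.min l (4 * (T + 1))^-1.
have h0 : 0 < h by rewrite lt_min l0 invr_gt0 mulr_gt0//; lra.
have hl : 0 < h <= l by rewrite h0 /h ge_min lexx.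
have hT : 2 * h * T <= 2^-1.
  have : h * (4 * (T + 1)) <= 1.
    by rewrite -ler_pdivlMr ?mulr_gt0//; [rewrite mul1r /h ge_min lexx orbT|lra].
  nra.
exists (1 + T * (2 / h)); first by rewrite addr_ge0// mulr_ge0// divr_ge0// ltW.
move=> u Hu.
pose S := 2 * h * dirichlet u + 2 / h * L2normsq u.
have S0 : 0 <= S.
  by rewrite addr_ge0// mulr_ge0 ?dirichlet_ge0 ?L2normsq_ge0 ?divr_ge0 ?mulr_ge0 ?ltW.
have uS := sup h hl u Hu.
have pot : - L2normsq u - S * \sum_e int (ivl e) (A e) <= potential_energy W u.
  rewrite /potential_energy /L2normsq /graph_integral mulr_sumr -sumrN -sumrB.
  apply: ler_sum => e _; have mI := measurable_edge e.
  have iu := integ_normc_sqr e Hu.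
  rewrite -mulN1r -(RintegralZl _ mI iu) -(RintegralZl _ mI (Ai e)).
  rewrite -(RintegralB mI (integZ mI _ iu) (integZ mI _ (Ai e))).
  apply: le_Rintegral => //.
  - exact: (integB mI (integZ mI _ iu) (integZ mI _ (Ai e))).
  - exact: integ_potential.
  move=> x Ix; have [A0 WA] := AW e x Ix.
  have n0 := sqr_ge0 (normc (u e x)); have nS := uS e x Ix.
  have h1 := ler_wpM2r n0 WA; have h2 := ler_wpM2l A0 nS.
  rewrite -/S in h2; nra.
have ver : \sum_(v : vertex G) alpha v * normc (at_vertex u v) ^+ 2 <= S * \sum_v `|alpha v|.
  rewrite mulr_sumr; apply: ler_sum => v _.
  apply: (le_trans (ler_wpM2r (sqr_ge0 _) (ler_norm (alpha v)))).
  by rewrite mulrC ler_wpM2r//; apply: at_vertex_le => //; exact: Hu.1.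
rewrite qformE.
have D0 := dirichlet_ge0 u.
have e1 : S * T = 2 * h * T * dirichlet u + T * (2 / h) * L2normsq u.
  by rewrite /S; ring.
have e2 := ler_wpM2r D0 hT.
have e3 : S * T = S * \sum_e int (ivl e) (A e) + S * \sum_v `|alpha v|.
  by rewrite /T; ring.
move: pot ver e1 e2 e3.
move: (dirichlet u) (L2normsq u) (potential_energy W u) (\sum_e int (ivl e) (A e))
  (\sum_v `|alpha v|) (\sum_v alpha v * normc (at_vertex u v) ^+ 2) => a1 a2 a3 a4 a5 a6.
by clearbody S T h; clear; lra.
Qed.

End potential.

(** * Lower semicontinuity of the energy *)

Section energy_liminf.
Context {R : realType} {G : metric_graph R}.
Local Notation mu := (@lebesgue_measure R).
Local Notation integ I f := (mu.-integrable I (EFin \o f)).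
Local Notation int I f := (Rintegral mu I f).
Local Notation ivl e := (interval_of e).
Implicit Types (u : graph_fun G) (e : edge G) (b : bool) (W : potential G) (p k c : R).

Definition nonlinear_energy p u : R :=
  graph_integral (fun e x => normc (u e x) `^ (p + 1)).

Definition bounded_by k u := forall e x, ivl e x -> normc (u e x) <= k.

(** For uniformly small functions the nonlinear term is a small multiple of the
    mass, whatever the supercritical exponent. *)
Lemma powR_le_sqr p k (n : R) : 5 <= p -> 0 <= n <= k -> k <= 1 -> n `^ (p + 1) <= k * n ^+ 2.
Proof.
move=> hp /andP[n0 nk] k1; have [->|nz] := eqVneq n 0.
  by rewrite powR0 ?expr0n/= ?mulr0// gt_eqF//; lra.
have np : 0 < n by rewrite lt_neqAle eq_sym nz.
apply: (@le_trans _ _ (n `^ 3%:R)).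
  by apply: ger_powR; [rewrite np (le_trans nk k1)|lra].
by rewrite powR_mulrn// exprSr mulrC ler_wpM2r// sqr_ge0.
Qed.

Lemma integ_nonlinear p k u e : 5 <= p -> k <= 1 -> H1 u -> bounded_by k u ->
  integ (ivl e) (fun x => normc (u e x) `^ (p + 1)).
Proof.
move=> hp k1 Hu uk; have mI := measurable_edge e.
apply: (integ_le mI _ (integ_normc_sqr e Hu)).
  by apply: (measurableT_comp (measurable_powR (p + 1))); exact: measurable_normc_H1.
move=> x Ix; rewrite ger0_norm ?powR_ge0//.
apply: (le_trans (powR_le_sqr hp _ k1)); first by rewrite normc_ge0 uk.
by rewrite -[leRHS]mul1r ler_wpM2r// sqr_ge0.
Qed.

Lemma nonlinear_energy_le p k u : 5 <= p -> k <= 1 -> H1 u -> bounded_by k u ->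
  nonlinear_energy p u <= k * L2normsq u.
Proof.
move=> hp k1 Hu uk; rewrite /nonlinear_energy /L2normsq /graph_integral mulr_sumr.
apply: ler_sum => e _; have mI := measurable_edge e.
rewrite -(RintegralZl _ mI (integ_normc_sqr e Hu)).
apply: le_Rintegral => //; [exact: integ_nonlinear uk|exact: integZ (integ_normc_sqr e Hu)|].
by move=> x Ix; apply: powR_le_sqr => //; rewrite normc_ge0 uk.
Qed.

Lemma nonlinear_energy_ge0 p u : 0 <= nonlinear_energy p u.
Proof. by apply: sumr_ge0 => e _; apply: Rintegral_ge0 => x _; exact: powR_ge0. Qed.

Lemma cvg_normc (z_ : nat -> R[i]) z : (forall b, cpt b (z_ n) @[n --> \oo] --> cpt b z) ->
  normc (z_ n) @[n --> \oo] --> normc z.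
Proof.
move=> cz.
have E w : normc w = Num.sqrt (cpt false w * cpt false w + cpt true w * cpt true w).
  by case: w.
rewrite E (_ : (fun n => _) = (fun n => Num.sqrt
  (cpt false (z_ n) * cpt false (z_ n) + cpt true (z_ n) * cpt true (z_ n)))).
  apply: continuous_cvg; first exact: sqrt_continuous.
  by apply: cvgD; apply: cvgM; exact: cz.
by apply/funext => n; exact: E.
Qed.

Lemma cvg_vertex_energy (alpha : vertex G -> R) (u_ : nat -> graph_fun G) u :
  (forall n, H1 (u_ n)) -> H1 u ->
  (forall e x, ivl e x -> normc (u_ n e x) @[n --> \oo] --> normc (u e x)) ->
  le_liminf (- \sum_v alpha v * normc (at_vertex u v) ^+ 2)
    (fun n => - \sum_v alpha v * normc (at_vertex (u_ n) v) ^+ 2).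
Proof.
move=> uH Hu uu; rewrite -sumrN.
rewrite (_ : (fun n => _) = (fun n => \sum_v - (alpha v * normc (at_vertex (u_ n) v) ^+ 2))); last first.
  by apply/funext => n; rewrite sumrN.
apply: (le_liminf_sum (u := fun v n => - (alpha v * normc (at_vertex (u_ n) v) ^+ 2))) => v.
have [[e [x av]]|nav] := pselect (exists e x, attached e x v).
  rewrite (at_vertexE Hu.1 av).
  rewrite (_ : (fun n => _) = (fun n => - (alpha v * (normc (u_ n e x) * normc (u_ n e x))))).
    have h := uu _ _ (attached_edge av).
    by apply: cvg_le_liminf; apply: cvgN; apply: cvgM; [exact: cvg_cst|exact: (cvgM h h)].
  by apply/funext => n; rewrite (at_vertexE (uH n).1 av).
have nav' e x : ~ attached e x v by move=> av; apply: nav; exists e, x.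
rewrite (_ : (fun n => _) = (fun=> - (alpha v * normc (at_vertex u v) ^+ 2))).
  exact: le_liminf_cst.
by apply/funext => n; rewrite !at_vertexN.
Qed.

(** Lower semicontinuity of the potential and nonlinear terms, although mass may
    escape to infinity and both have parts of the wrong sign.  After adding
    d + A, with A integrable, to the potential, and k times the mass to the
    nonlinear term, the integrand is nonnegative and Fatou's lemma applies.  The
    term with A passes to the limit by dominated convergence, and [d] is
    arbitrarily small; so escaping mass costs at least - [k] times itself, not
    - lambda0 times itself. *)
Lemma potential_liminf W p k c X (u_ : nat -> graph_fun G) u :
  admissible W -> 5 <= p -> 0 <= k <= 1 ->
  (forall n, H1 (u_ n)) -> (forall n, bounded_by k (u_ n)) ->
  (forall n, L2normsq (u_ n) = c) -> (forall n, potential_energy W (u_ n) <= X) ->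
  H1 u -> bounded_by k u ->
  (forall e x, ivl e x -> normc (u_ n e x) @[n --> \oo] --> normc (u e x)) ->
  le_liminf (potential_energy W u - 2 / (p + 1) * nonlinear_energy p u + k * L2normsq u)
    (fun n => potential_energy W (u_ n) - 2 / (p + 1) * nonlinear_energy p (u_ n) + k * c).
Proof.
move=> aW hp /andP[k0 k1] uH uk uc uX Hu ukk uu.
pose s := 2 / (p + 1); have s0 : 0 <= s by rewrite divr_ge0//; lra.
have s1 : s <= 1 by rewrite ler_pdivrMr; lra.
have c0 : 0 <= c by rewrite -(uc 0%N) L2normsq_ge0.
have key d : 0 < d -> le_liminf
    (potential_energy W u - s * nonlinear_energy p u + (d + k) * L2normsq u)
    (fun n => potential_energy W (u_ n) - s * nonlinear_energy p (u_ n) + (d + k) * c).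
  move=> d0; have ex e := (aW e).2 d d0.
  pose A e := projT1 (cid2 (ex e)).
  have Ai e : integ (ivl e) (A e) by rewrite /A; case: cid2.
  have AW e x : ivl e x -> 0 <= A e x /\ - (d + A e x) <= W e x.
    by rewrite /A; case: cid2 => ? ? h; exact: h.
  (* forget how the family was chosen *)
  have AE : exists B : potential G, B = A by exists A.
  have {AE} [B BA] := AE; rewrite -{}BA in Ai AW; clear A.
  pose V (w : graph_fun G) (e : edge G) (x : R) : R := W e x * normc (w e x) ^+ 2 - s * (normc (w e x) `^ (p + 1))
    + (d + k) * normc (w e x) ^+ 2 + B e x * normc (w e x) ^+ 2.
  have iBn (w : graph_fun G) (e : edge G) : H1 w -> bounded_by k w -> integ (ivl e) (fun x => B e x * normc (w e x) ^+ 2).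
    move=> Hw wk; apply: (integ_le (measurable_edge e) _ (Ai e)).
      apply: (@measurable_funM _ (measurableTypeR R)); first exact: integ_mfun (Ai e).
      exact: integ_mfun (integ_normc_sqr e Hw).
    move=> x Ix; have [B0 _] := AW e x Ix.
    rewrite ger0_norm ?(mulr_ge0 B0 (sqr_ge0 _))//.
    by rewrite ler_piMr// expr_le1 ?normc_ge0// (le_trans (wk e x Ix)).
  have iV : forall (w : graph_fun G) (e : edge G), H1 w -> bounded_by k w -> integ (ivl e) (V w e) /\
      int (ivl e) (V w e) = int (ivl e) (fun x => W e x * normc (w e x) ^+ 2)
        - s * int (ivl e) (fun x => normc (w e x) `^ (p + 1))
        + (d + k) * int (ivl e) (fun x => normc (w e x) ^+ 2)
        + int (ivl e) (fun x => B e x * normc (w e x) ^+ 2).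
    move=> w e Hw wk; have mI := measurable_edge e.
    have i1 := integ_potential e aW Hw; have i2 := integ_nonlinear e hp k1 Hw wk.
    have i3 := integ_normc_sqr e Hw; have i4 := iBn w e Hw wk.
    have j1 := integB mI i1 (integZ mI s i2).
    have j2 := integD mI j1 (integZ mI (d + k) i3).
    split; first exact: (integD mI j2 i4).
    rewrite -(RintegralZl s mI i2) -(RintegralB mI i1 (integZ mI s i2)).
    rewrite -(RintegralZl (d + k) mI i3) -(RintegralD mI j1 (integZ mI (d + k) i3)).
    by rewrite -(RintegralD mI j2 i4).
  have V0 (w : graph_fun G) (e : edge G) (x : R) : bounded_by k w -> ivl e x -> 0 <= V w e x.
    move=> wk Ix; have [B0 WB] := AW e x Ix.
    have n2 := sqr_ge0 (normc (w e x)).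
    have := powR_le_sqr hp (_ : 0 <= normc (w e x) <= k) k1.
    rewrite normc_ge0 wk// => /(_ erefl) P1.
    have P0 := powR_ge0 (normc (w e x)) (p + 1).
    have h1 := ler_wpM2r n2 WB.
    have h2 : s * normc (w e x) `^ (p + 1) <= k * normc (w e x) ^+ 2.
      by apply: le_trans P1; rewrite -[leRHS]mul1r ler_wpM2r.
    rewrite /V; lra.
  have sumV (w : graph_fun G) : H1 w -> bounded_by k w -> \sum_e int (ivl e) (V w e) =
      potential_energy W w - s * nonlinear_energy p w + (d + k) * L2normsq w
      + \sum_e int (ivl e) (fun x => B e x * normc (w e x) ^+ 2).
    move=> Hw wk.
    rewrite /potential_energy /nonlinear_energy /L2normsq /graph_integral !mulr_sumr.
    rewrite -sumrB -!big_split /=; apply: eq_bigr => e _.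
    by have [_ ->] := iV w e Hw wk.
  have LV : le_liminf (\sum_e int (ivl e) (V u e)) (fun n => \sum_e int (ivl e) (V (u_ n) e)).
    apply: (le_liminf_sum (u := fun e n => int (ivl e) (V (u_ n) e))) => e.
    have [_ H] : integ (ivl e) (V u e) /\
        le_liminf (int (ivl e) (V u e)) (fun n => int (ivl e) (V (u_ n) e)); last exact: H.
    have mI := measurable_edge e.
    apply: (@fatou_real _ _ _ mu (ivl e) mI (fun n => V (u_ n) e) _
      (X + (d + k) * c + \sum_e int (ivl e) (B e))).
    - by move=> n; have [] := iV (u_ n) e (uH n) (uk n).
    - by move=> n x; exact: V0.
    - by have [i _] := iV u e Hu ukk; exact: integ_mfun i.
    - by move=> x; exact: V0.
    - apply: aeW => x Ix; have h := uu e x Ix; have h2 := cvgM h h.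
      have hp1 : 0 < p + 1 by lra.
      have h3 := cvg_powR hp1 (fun n => normc_ge0 (u_ n e x)) h.
      rewrite /V; apply: cvgD; last by apply: cvgM; [exact: cvg_cst|exact: h2].
      apply: cvgD; last by apply: cvgM; [exact: cvg_cst|exact: h2].
      by apply: cvgB; apply: cvgM; [exact: cvg_cst|exact: h2|exact: cvg_cst|exact: h3].
    - move=> n.
      apply: (@le_trans _ _ (\sum_e int (ivl e) (V (u_ n) e))).
        rewrite [leRHS](bigD1 e)//= lerDl sumr_ge0// => e' _.
        by apply: Rintegral_ge0 => x; exact: V0.
      rewrite sumV// uc; apply: lerD.
        rewrite lerD2r; have := uX n; have := nonlinear_energy_ge0 p (u_ n); nra.
      apply: ler_sum => e' _; apply: le_Rintegral; [exact: measurable_edge|exact: iBn|exact: Ai|].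
      move=> x Ix; have [B0 _] := AW e' x Ix.
      rewrite ler_piMr// expr_le1 ?normc_ge0// (le_trans (uk n e' x Ix))//.
  have LB : le_liminf (\sum_e - int (ivl e) (fun x => B e x * normc (u e x) ^+ 2))
      (fun n => \sum_e - int (ivl e) (fun x => B e x * normc (u_ n e x) ^+ 2)).
    apply: (le_liminf_sum (u := fun e n => - int (ivl e) (fun x => B e x * normc (u_ n e x) ^+ 2))) => e.
    apply: cvg_le_liminf; apply: cvgN.
    apply: (dominated_cvg_real (measurable_edge e) _ _ (Ai e)).
    - by move=> n; exact: integ_mfun (iBn _ e (uH n) (uk n)).
    - move=> x Ix; have h := uu e x Ix.
      by apply: cvgM; [exact: cvg_cst|exact: (cvgM h h)].
    - move=> n x Ix; have [B0 _] := AW e x Ix.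
      rewrite ger0_norm ?(mulr_ge0 B0 (sqr_ge0 _))// ler_piMr//.
      by rewrite expr_le1 ?normc_ge0// (le_trans (uk n e x Ix)).
  have := le_liminfD LV LB; rewrite sumV// sumrN addrK.
  rewrite (_ : (_ \+ _) = (fun n => potential_energy W (u_ n)
    - s * nonlinear_energy p (u_ n) + (d + k) * c))//.
  by apply/funext => n /=; rewrite sumV// sumrN addrK uc.
move=> e e0; pose d := e / (2 * (c + 1)).
have d0 : 0 < d by rewrite divr_gt0// mulr_gt0//; lra.
have dc : d * c <= e / 2.
  have -> : e / 2 = d * (c + 1) by rewrite /d; field; rewrite gt_eqF//; lra.
  by rewrite ler_wpM2l ?ltW//; lra.
have e2 : 0 < e / 2 by lra.
have := key d d0 _ e2; apply: filterS => n H.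
have L0 := mulr_ge0 (ltW d0) (L2normsq_ge0 u).
rewrite -/s; move: H L0 dc; rewrite !mulrDl.
move: (d * L2normsq u) (d * c) (s * nonlinear_energy p u)
  (s * nonlinear_energy p (u_ n)) => a1 a2 a3 a4.
by clear; lra.
Qed.

End energy_liminf.

(** * Minimization on small spheres *)

Section minimization.
Context {R : realType} {G : metric_graph R}.
Local Notation ivl e := (interval_of e).
Implicit Types (u : graph_fun G) (e : edge G) (W : potential G) (alpha : vertex G -> R) (c r p k : R).

Lemma double_energy W alpha p u :
  2 * energy W alpha p u = qform W alpha u - 2 / (p + 1) * nonlinear_energy p u.
Proof. by rewrite /energy /nonlinear_energy mulrBr !mulrA divff ?mul1r. Qed.

(** A positive lambda0 is not the default value of an infimum, so that almost
    minimal functions of mass 1 exist. *)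
Lemma lambda0_witness W alpha : 0 < lambda0 W alpha ->
  exists psi, [/\ H1 psi, L2normsq psi = 1 & qform W alpha psi < - (lambda0 W alpha / 2)].
Proof.
move=> l0; set S := [set qform W alpha u | u in [set u | H1 u /\ L2normsq u = 1]].
have l0E : lambda0 W alpha = - inf S by [].
have hS : has_inf S.
  by apply: contrapT => nS; move: l0; rewrite l0E inf_out// oppr0 ltxx.
have l2 : 0 < lambda0 W alpha / 2 by lra.
have [_ [psi [Hp cp] <-] lt] := inf_adherent l2 hS.
by exists psi; split => //; move: lt; rewrite -[inf S]opprK -l0E; lra.
Qed.

(** Scaling an almost minimal function of mass 1.  As its form is negative, the
    scaled function satisfies the constraint of the ball as soon as the mass part
    of the G-norm does. *)
Lemma competitor W alpha c r : admissible W -> 0 < lambda0 W alpha -> 0 < c ->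
  2 * lambda0 W alpha * c <= r ->
  exists u, [/\ mass_sphere c u, Gball W alpha r u &
    qform W alpha u <= - (lambda0 W alpha / 2 * c)].
Proof.
move=> aW l0 c0 cr; have [psi [Hp mp qp]] := lambda0_witness l0.
have [Hu _] := H1_gscale (Num.sqrt c) Hp.
have mu' : L2normsq (gscale (Num.sqrt c) psi) = c.
  by rewrite L2normsq_gscale// mp mulr1 sqr_sqrtr// ltW.
have qu : qform W alpha (gscale (Num.sqrt c) psi) <= - (lambda0 W alpha / 2 * c).
  by rewrite qform_gscale ?sqrtr_ge0// sqr_sqrtr ?ltW//; nra.
exists (gscale (Num.sqrt c) psi); split => //; split => //.
by rewrite /Gnormsq mu'; nra.
Qed.

(** Coercivity bounds the Dirichlet integral independently of [c]; [H1_sup] with a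
    small parameter and a small mass then makes the supremum small. *)
Lemma small_mass_bounded W alpha r k : admissible W -> 0 <= lambda0 W alpha -> 0 < r -> 0 < k ->
  exists2 cstar : R, 0 < cstar <= 1 & exists K, forall c u, 0 < c < cstar ->
    mass_sphere c u -> Gball W alpha r u -> dirichlet u <= K /\ bounded_by k u.
Proof.
move=> aW l0 r0 k0; have [l lp sup] := @H1_sup R G.
have [C C0 coer] := qform_coercive alpha aW.
pose K := 2 * (r + C).
have K0 : 0 < K by rewrite mulr_gt0//; lra.
pose h := Num.min l (k ^+ 2 / (4 * K)).
have k2 : 0 < k ^+ 2 by exact: exprn_gt0.
have h0 : 0 < h by rewrite lt_min lp divr_gt0// mulr_gt0.
have hl : 0 < h <= l by rewrite h0 /h ge_min lexx.
have hK : h * (4 * K) <= k ^+ 2.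
  have K4 : 0 < 4 * K by exact: mulr_gt0.
  by rewrite -(ler_pdivlMr _ _ K4) /h ge_min lexx orbT.
exists (Num.min 1 (k ^+ 2 * h / 4)).
  apply/andP; split; last by rewrite ge_min lexx.
  by rewrite lt_min ltr01 /= divr_gt0// mulr_gt0.
exists K => c u /andP[c0]; rewrite lt_min => /andP[c1 ck] [Hu mc] [_ Gr].
have Du : dirichlet u <= K.
  have := coer u Hu; move: Gr; rewrite /Gnormsq mc /K.
  move: (dirichlet u) (qform W alpha u) (lambda0 W alpha) l0 => D F L; clear -c0 c1 C0.
  nra.
split => // e x Ix.
rewrite -(@ler_pXn2r _ 2) ?nnegrE ?normc_ge0 ?(ltW k0)//.
apply: le_trans (sup h hl u Hu e x Ix) _; rewrite mc.
have h1 : 2 * h * dirichlet u <= k ^+ 2 / 2.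
  apply: (@le_trans _ _ (2 * h * K)); first by rewrite ler_wpM2l// mulr_ge0// ltW.
  by move: hK; clear; lra.
have h2 : 2 / h * c <= k ^+ 2 / 2.
  rewrite mulrAC ler_pdivrMr//; move: ck; clear; lra.
lra.
Qed.

(** With [b] the mass and [q] twice the energy of the limit of a minimizing
    sequence for [v]: multiplying by b, the hypotheses combine to
    (c - b) (2 v + k c) >= 0. *)
Lemma no_mass_loss (v k c b q : R) : 0 < b -> b <= c ->
  2 * v <= c / b * q -> q <= 2 * v + k * (c - b) -> 2 * v + k * c < 0 -> b = c.
Proof.
move=> b0 bc vq qv vk.
have cb : 0 <= c / b by rewrite divr_ge0 ?(ltW b0) ?(le_trans (ltW b0) bc).
have : 2 * v * b <= c * (2 * v + k * (c - b)).
  rewrite -ler_pdivlMr// mulrAC.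
  exact: le_trans vq (ler_wpM2l cb qv).
by move=> h; apply/eqP; rewrite eq_le bc -subr_le0 -(nmulr_rge0 _ vk); move: h; clear; lra.
Qed.

Lemma mass_le_liminf c (u_ : nat -> graph_fun G) u : (forall n, H1 (u_ n)) ->
  (forall n, L2normsq (u_ n) = c) -> H1 u ->
  (forall e x, ivl e x -> normc (u_ n e x) @[n --> \oo] --> normc (u e x)) ->
  L2normsq u <= c.
Proof.
move=> uH uc Hu uu.
suff H : le_liminf (L2normsq u) (fun n => L2normsq (u_ n)).
  by apply: (le_liminf_lim (cvg_cst c)); move: H; under eq_fun do rewrite uc.
apply: (le_liminf_sum (u := fun e n => Rintegral lebesgue_measure (ivl e)
  (fun x => normc (u_ n e x) ^+ 2))) => e.
have [_ H] : (@lebesgue_measure R).-integrable (ivl e) (EFin \o (fun x => normc (u e x) ^+ 2)) /\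
  le_liminf (Rintegral lebesgue_measure (ivl e) (fun x => normc (u e x) ^+ 2))
    (fun n => Rintegral lebesgue_measure (ivl e) (fun x => normc (u_ n e x) ^+ 2));
  last exact: H.
apply: (@fatou_real _ _ _ _ _ (measurable_edge e) (fun n x => normc (u_ n e x) ^+ 2) _ c).
- by move=> n; exact: integ_normc_sqr.
- by move=> n x _; exact: sqr_ge0.
- exact: integ_mfun (integ_normc_sqr e Hu).
- by move=> x _; exact: sqr_ge0.
- by apply: aeW => x Ix; have h := uu e x Ix; exact: (cvgM h h).
- move=> n; rewrite -(uc n) /L2normsq /graph_integral [leRHS](bigD1 e)//= lerDl sumr_ge0// => e' _.
  by apply: Rintegral_ge0 => x _; exact: sqr_ge0.
Qed.

End minimization.

Unset Implicit Arguments.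

Theorem theorem1p2 (R : realType) (G : metric_graph R) (W : potential G)
    (alpha : vertex G -> R) (p : R) (hp : 5 <= p)
    (h1 : assumption1 G) (h2 : assumption2 p W) (h3 : assumption3 W alpha) :
  forall r : R, 0 < r -> exists2 cstar : R, 0 < cstar &
    (forall c : R, 0 < c < cstar ->
       mass_sphere c `&` Gball W alpha r !=set0 /\
       (-oo < nu W alpha p r c)%E) /\
    (forall c : R, 0 < c < cstar ->
       (exists u : graph_fun G,
          [/\ H1 u, (mass_sphere c `&` Gball W alpha r) u &
              (energy W alpha p u)%:E = nu W alpha p r c]) /\
       minimizers W alpha p r c !=set0).
Proof.
move=> r r0; have [l0 _] := h3; have aW := assumption2_admissible h2.
pose L := lambda0 W alpha.
(* the bound imposed on the functions, which makes the nonlinear term small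
   with respect to the gap L between the ground state energy and 0 *)
pose k := Num.min 1 (L / 4).
have k0 : 0 < k by rewrite lt_min ltr01 divr_gt0.
have k1 : k <= 1 by rewrite /k ge_min lexx.
have kL : k <= L / 4 by rewrite /k ge_min lexx orbT.
have [c0 /andP[c00 c01] [K bnd]] := small_mass_bounded aW (ltW l0) r0 k0.
have [C C0 coer] := qform_coercive alpha aW.
pose s := 2 / (p + 1).
have s0 : 0 <= s by rewrite divr_ge0//; lra.
have s1 : s <= 1 by rewrite ler_pdivrMr; lra.
pose cstar := Num.min c0 (r / (2 * L)).
have rL : 0 < r / (2 * L) by rewrite divr_gt0// mulr_gt0.
have cs0 : 0 < cstar by rewrite lt_min c00.
have csP (c : R) : 0 < c < cstar -> 0 < c < c0 /\ 2 * L * c <= r.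
  move=> /andP[cp]; rewrite lt_min => /andP[h4 h5]; rewrite cp h4; split => //.
  by rewrite mulrC -ler_pdivlMr ?mulr_gt0// ltW.
have nonempty (c : R) : 0 < c < cstar -> mass_sphere c `&` Gball W alpha r !=set0.
  move=> cc; have [_ cr] := csP c cc; have /andP[cp _] := cc.
  by have [u [mu' Gu _]] := competitor aW l0 cp cr; exists u.
have lower (c : R) u : 0 < c < cstar -> (mass_sphere c `&` Gball W alpha r) u ->
    (- (C + k) * c) / 2 <= energy W alpha p u.
  move=> cc [mc Gu]; have [cc0 _] := csP c cc; have [Hu mcu] := mc.
  have [_ uk] := bnd c u cc0 mc Gu.
  have N1 := nonlinear_energy_le hp k1 Hu uk.
  have N0 := nonlinear_energy_ge0 p u.
  have E := double_energy W alpha p u; have Q := coer u Hu; have D0 := dirichlet_ge0 u.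
  rewrite mcu in N1 Q.
  have sN : s * nonlinear_energy p u <= k * c.
    by apply: le_trans N1; rewrite ler_piMl.
  rewrite -/s in E; lra.
have nuNy (c : R) : 0 < c < cstar -> (-oo < nu W alpha p r c)%E.
  move=> cc; apply: (@lt_le_trans _ _ ((- (C + k) * c) / 2)%:E); first by rewrite ltNyr.
  by apply: le_ereal_inf_tmp => _ [u Su <-]; rewrite lee_fin; exact: lower.
exists cstar => //; split; first by move=> c cc; split; [exact: nonempty|exact: nuNy].
move=> c cc.
suff [u [Su Eu]] : exists u, (mass_sphere c `&` Gball W alpha r) u /\
    (energy W alpha p u)%:E = nu W alpha p r c.
  by split; exists u; split => //; have [[]] := Su.
have [cc0 cr] := csP c cc; have /andP[cp _] := cc.
have nulb u : (mass_sphere c `&` Gball W alpha r) u -> (nu W alpha p r c <= (energy W alpha p u)%:E)%E.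
  by move=> Su; apply: ereal_inf_lbound; exists u.
have nufin : nu W alpha p r c \is a fin_num.
  have [u Su] := nonempty c cc; rewrite fin_numE; apply/andP; split.
    by rewrite gt_eqF// nuNy.
  by rewrite lt_eqF// (le_lt_trans (nulb u Su))// ltry.
pose v := fine (nu W alpha p r c).
have vE : nu W alpha p r c = v%:E by rewrite fineK.
have vlb u : (mass_sphere c `&` Gball W alpha r) u -> v <= energy W alpha p u.
  by move=> /nulb; rewrite vE lee_fin.
have [w [mw Gw qw]] := competitor aW l0 cp cr.
(* the infimum lies well below the energy - k c / 2 that escaping mass can reach *)
have v2 : 2 * v <= - (L / 2 * c).
  have vw := vlb w (conj mw Gw); have := double_energy W alpha p w.
  have := mulr_ge0 s0 (nonlinear_energy_ge0 p w); rewrite -/s; lra.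
have exn n : exists u, (mass_sphere c `&` Gball W alpha r) u /\
    energy W alpha p u <= v + n.+1%:R^-1.
  have n0 : 0 < (n.+1%:R^-1 : R) by rewrite invr_gt0.
  have : (nu W alpha p r c < (v + n.+1%:R^-1)%:E)%E by rewrite vE lte_fin ltrDl.
  move=> /ereal_inf_lt[_ [u Su <-]]; rewrite lte_fin => /ltW ?.
  by exists u.
pose u_ n := projT1 (cid (exn n)).
have uS n : (mass_sphere c `&` Gball W alpha r) (u_ n) by rewrite /u_; case: cid => ? [].
have uE n : energy W alpha p (u_ n) <= v + n.+1%:R^-1 by rewrite /u_; case: cid => ? [].
have uH n : H1 (u_ n) by have [[]] := uS n.
have um n : L2normsq (u_ n) = c by have [[]] := uS n.
have uDk n : dirichlet (u_ n) <= K /\ bounded_by k (u_ n).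
  by have [? ?] := uS n; exact: (bnd c).
have umc n : L2normsq (u_ n) <= c by rewrite um.
have [t [u [tk Hu uc Du]]] := H1_compactness uH (fun n => (uDk n).1) umc.
pose w_ n := u_ (t n).
have un e x : interval_of e x -> normc (w_ n e x) @[n --> \oo] --> normc (u e x).
  by move=> Ix; apply: cvg_normc; exact: uc.
have wk n : bounded_by k (w_ n) by exact: (uDk (t n)).2.
have uk : bounded_by k u.
  move=> e x Ix; rewrite -(cvg_lim (@norm_hausdorff _ R) (un e x Ix)).
  by apply: limr_le; [apply/cvg_ex; exists (normc (u e x)); exact: un|
    apply: nearW => n; exact: wk].
have mb : L2normsq u <= c := mass_le_liminf (fun n => uH (t n)) (fun n => um (t n)) Hu un.
have k2 : k ^+ 2 <= 1 by rewrite expr_le1// ltW.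
have pX n : potential_energy W (w_ n) <= r + \sum_v `|alpha v|.
  have [_ [_ Gn]] := uS (t n); move: Gn; rewrite /Gnormsq um qformE => Gn.
  have D0 := dirichlet_ge0 (w_ n); have Lc : 0 <= 2 * L * c by rewrite !mulr_ge0// ltW.
  have A : \sum_v alpha v * normc (at_vertex (w_ n) v) ^+ 2 <= \sum_v `|alpha v|.
    apply: ler_sum => x _; apply: (le_trans (ler_wpM2r (sqr_ge0 _) (ler_norm (alpha x)))).
    rewrite ler_piMr//; apply: at_vertex_le => //; first exact: (uH (t n)).1.
    by move=> e y Iy; rewrite expr_le1 ?normc_ge0// (le_trans (wk n e y Iy)).
  by move: Gn A; rewrite -/L -/(w_ n); lra.
have k01 : 0 <= k <= 1 by rewrite ltW.
have P := potential_liminf aW hp k01 (fun n => uH (t n)) wk (fun n => um (t n)) pX Hu uk un.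
have V := cvg_vertex_energy alpha (fun n => uH (t n)) Hu un.
(* the mass c - |u|^2 lost in the limit contributes at least - k times itself *)
have key : qform W alpha u - s * nonlinear_energy p u + k * L2normsq u <= 2 * v + k * c.
  have cv : 2 * (v + n.+1%:R^-1) + k * c @[n --> \oo] --> 2 * v + k * c.
    have -> : 2 * v + k * c = 2 * (v + 0) + k * c by rewrite addr0.
    apply: cvgD; last exact: cvg_cst; apply: cvgM; first exact: cvg_cst.
    by apply: cvgD; [exact: cvg_cst|exact: cvg_harmonic].
  apply: (le_liminf_lim cv).
  have := le_liminfD (le_liminfD Du P) V; rewrite -/s.
  have -> : dirichlet u + (potential_energy W u - s * nonlinear_energy p u + k * L2normsq u)
      - \sum_v alpha v * normc (at_vertex u v) ^+ 2 =
      qform W alpha u - s * nonlinear_energy p u + k * L2normsq u by rewrite qformE; ring.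
  apply: le_liminf_le => n /=.
  have En := double_energy W alpha p (w_ n); rewrite qformE -/s in En.
  have En2 := uE (t n); rewrite -/(w_ n) in En2.
  have tn : (t n).+1%:R^-1 <= n.+1%:R^-1 :> R by rewrite lef_pV2 ?posrE// ler_nat ltnS.
  rewrite -/(w_ n).
  move: En En2 tn; move: ((t n).+1%:R^-1 : R) (n.+1%:R^-1 : R) => a1 a2; lra.
have N1 := nonlinear_energy_le hp k1 Hu uk; have N0 := nonlinear_energy_ge0 p u.
have sN0 : 0 <= s * nonlinear_energy p u by exact: mulr_ge0.
have sN : s * nonlinear_energy p u <= k * L2normsq u.
  by apply: le_trans N1; rewrite ler_piMl.
have Q := coer u Hu; have D0 := dirichlet_ge0 u; have b0 := L2normsq_ge0 u.
have kc : k * c <= L / 4 * c by rewrite ler_wpM2r// ltW.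
have Lc : 0 < L * c by exact: mulr_gt0.
(* hence the limit does not vanish, and rescaling it stays inside the ball *)
have qneg : qform W alpha u < 0.
  by move: key sN v2 kc Lc; clear; clearbody s v k L; lra.
have bpos : 0 < L2normsq u.
  rewrite lt_neqAle b0 andbT eq_sym; apply/eqP => bE.
  by rewrite bE mulr0 in Q; move: Q qneg D0; clear; lra.
pose tt := Num.sqrt (c / L2normsq u).
have tt2 : tt ^+ 2 = c / L2normsq u by rewrite sqr_sqrtr// divr_ge0// ltW.
have tt1 : 1 <= tt ^+ 2 by rewrite tt2 ler_pdivlMr// mul1r.
have Smt : (mass_sphere c `&` Gball W alpha r) (gscale tt u).
  have [Ht _] := H1_gscale tt Hu.
  have mt : L2normsq (gscale tt u) = c by rewrite L2normsq_gscale// tt2 divfK ?gt_eqF.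
  split; first by [].
  split => //; rewrite /Gnormsq mt qform_gscale ?sqrtr_ge0//.
  have tq : tt ^+ 2 * qform W alpha u <= 0 by rewrite mulr_ge0_le0 ?sqr_ge0 ?(ltW qneg).
  by move: tq cr; rewrite -/L; clear; clearbody tt L; lra.
have vt := vlb _ Smt.
have et := double_energy W alpha p (gscale tt u).
rewrite qform_gscale ?sqrtr_ge0// -/s in et.
have nt : tt ^+ 2 * nonlinear_energy p u <= nonlinear_energy p (gscale tt u).
  rewrite /nonlinear_energy /graph_integral mulr_sumr; apply: ler_sum => e _.
  have mI := measurable_edge e; have iN := integ_nonlinear e hp k1 Hu uk.
  have tt0 : 0 <= tt by exact: sqrtr_ge0.
  have tt11 : 1 <= tt by rewrite -(@ler_pXn2r _ 2) ?nnegrE// expr1n.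
  have E x : normc (gscale tt u e x) `^ (p + 1) = tt `^ (p + 1) * normc (u e x) `^ (p + 1).
    by rewrite normc_scale// powRM// normc_ge0.
  have -> : \int[@lebesgue_measure R]_(x in interval_of e) (normc (gscale tt u e x) `^ (p + 1)) =
      \int[@lebesgue_measure R]_(x in interval_of e) (tt `^ (p + 1) * normc (u e x) `^ (p + 1)).
    by apply: eq_Rintegral => x _; exact: E.
  rewrite (RintegralZl _ mI iN) ler_wpM2r//.
    by apply: Rintegral_ge0 => x _; exact: powR_ge0.
  rewrite -powR_mulrn//; apply: ler_powR => //.
  by move: hp; clear; lra.
(* restoring the lost mass by scaling would otherwise beat the infimum *)
have m0 : L2normsq u = c.
  have snt := ler_wpM2l s0 nt.
  apply: (no_mass_loss (v := v) (k := k) (q := qform W alpha u - s * nonlinear_energy p u)) => //.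
  - rewrite -tt2 mulrBr [X in _ <= _ - X]mulrCA; move: vt et snt.
    by clear; clearbody s v tt; lra.
  - by move: key; clear; lra.
  - by move: v2 kc Lc; clear; lra.
have Gu : Gball W alpha r u.
  split => //; rewrite /Gnormsq m0 -/L; move: qneg cr.
  by clear; clearbody L; lra.
exists u; split; first by [].
rewrite vE; congr EFin; apply/eqP; rewrite eq_le; apply/andP; split; last exact: vlb.
rewrite m0 in key; move: (double_energy W alpha p u) key; rewrite -/s.
by clear; clearbody s v k; lra.
Qed.
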